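(* Let $d\ge 2$ be an integer and $\ell\in\{1,\dots,d\}$. One has $$\mathring\mu_{2d}(d|\ell)_1\le \frac{2d^2}{2d-\ell}.$$
   Context: A subspace of $\mathbb{R}^n$ is rational if it has a basis of vectors with rational coordinates; $\mathfrak{R}_n(e)$ denotes the set of rational subspaces of $\mathbb{R}^n$ of dimension $e$. A subspace $A$ of $\mathbb{R}^n$ is $(e,j)$-irrational if $\dim(A\cap B)<j$ for all $B\in\mathfrak{R}_n(e)$; $\mathfrak{I}_n(d,e)_j$ denotes the set of all $(e,j)$-irrational subspaces of dimension $d$ of $\mathbb{R}^n$. Height: for $B\in\mathfrak{R}_n(e)$, let $\Xi\in\mathbb{Z}^N$, $N=\binom ne$, be a vector of Pl\''ucker coordinates of $B$ which is integral with setwise coprime coordinates; $H(B)=\Vert\Xi\Vert$ (Euclidean norm). Equivalently $H(B)$ is the covolume of $B\cap\mathbb{Z}^n$ in $B$. Proximity: $\mathbb{R}^n$ has its standard Euclidean structure. For nonzero $X,Y\in\mathbb{R}^n$, $\psi(X,Y)=\Vert X\wedge Y\Vert/(\Vert X\Vert\,\Vert Y\Vert)$ is the sine of the angle between $X$ and $Y$. For subspaces $A,B$ of $\mathbb{R}^n$ of dimensions $d,e\ge 1$ and $t=\min(d,e)$, define inductively $\psi_1(A,B)=\min\{\psi(X,Y): X\in A\setminus\{0\},Y\in B\setminus\{0\}\}$, attained at unit vectors $X_1\in A$, $Y_1\in B$; and, given $(X_1,Y_1),\dots,(X_j,Y_j)$ with $j<t$, let $A_j$ (resp. $B_j$) be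 the orthogonal complement of $\mathrm{Span}(X_1,\dots,X_j)$ in $A$ (resp. of $\mathrm{Span}(Y_1,\dots,Y_j)$ in $B$), and $\psi_{j+1}(A,B)=\min\{\psi(X,Y): X\in A_j\setminus\{0\},Y\in B_j\setminus\{0\}\}$, attained at unit vectors $X_{j+1},Y_{j+1}$. (These are the sines of the canonical angles between $A$ and $B$ and do not depend on the choices.) Exponents: let $n\ge 2$, $d,e\in\{1,\dots,n-1\}$ with $d+e\le n$, $j\in\{1,\dots,\min(d,e)\}$. For $A\in\mathfrak{I}_n(d,e)_j$, $\mu_n(A|e)_j\in[0,+\infty]$ is the supremum of all $\beta>0$ such that $\psi_j(A,B)\le H(B)^{-\beta}$ holds for infinitely many $B\in\mathfrak{R}_n(e)$. Set $\mathring\mu_n(d|e)_j=\inf_{A\in\mathfrak{I}_n(d,e)_j}\mu_n(A|e)_j$. *)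

(* Defs.v *)
From mathcomp Require Import all_boot all_order all_algebra.
From mathcomp Require Import all_classical all_reals all_analysis.

Set Implicit Arguments.
Unset Strict Implicit.
Unset Printing Implicit Defensive.

Import Order.TTheory GRing.Theory Num.Theory.

Local Open Scope classical_set_scope.
Local Open Scope ring_scope.

Section Euclidean.
Context {R : realType} {n : nat}.
Implicit Types (X Y : 'rV[R]_n) (A S : {vspace 'rV[R]_n}).

Definition dotp X Y : R := \sum_(i < n) X 0 i * Y 0 i.

(* MathComp-Analysis equips 'rV[R]_n with the sup norm, so `|X| is not used. *)
Definition enorm X : R := Num.sqrt (dotp X X).

(* Euclidean norm of X /\ Y, in the orthonormal basis (e_i /\ e_k), i < k. *)
Definition wedge_norm X Y : R :=
  Num.sqrt (\sum_(i < n) \sum_(k < n | (i < k)%N)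
    (X 0 i * Y 0 k - X 0 k * Y 0 i) ^+ 2).

Definition psi X Y : R := wedge_norm X Y / (enorm X * enorm Y).

Definition orth_compl A S : set 'rV[R]_n :=
  [set v | v \in A /\ forall w, w \in S -> dotp v w = 0].

End Euclidean.

Section Proximity.
Context {R : realType} {n : nat}.
Implicit Types (A B : {vspace 'rV[R]_n}) (X Y : nat -> 'rV[R]_n).

Definition span_first X (k : nat) : {vspace 'rV[R]_n} :=
  <<[seq X i | i <- iota 1 k]>>%VS.

(* (X_1, Y_1), ..., (X_j, Y_j) are successive choices of minimizing pairs;
   only the values of X and Y at 1, ..., j matter. *)
Definition canonical_pairs A B (j : nat) X Y : Prop :=
  forall k, (k < j)%N ->
    let Ak := orth_compl A (span_first X k) in
    let Bk := orth_compl B (span_first Y k) in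
    [/\ Ak (X k.+1), Bk (Y k.+1), enorm (X k.+1) = 1, enorm (Y k.+1) = 1 &
        forall V W, Ak V -> Bk W -> V != 0 -> W != 0 ->
          psi (X k.+1) (Y k.+1) <= psi V W].

(* Meaningful for 1 <= j <= min (\dim A) (\dim B), where the set below is a
   singleton: the value does not depend on the choice of the pairs. *)
Definition psi_ (j : nat) A B : R :=
  xget 0 [set s | exists X Y, canonical_pairs A B j X Y /\ s = psi (X j) (Y j)].

End Proximity.

Section Rational.
Context {R : realType} {n : nat}.
Implicit Types (A B : {vspace 'rV[R]_n}).

Definition rational_subspace B : Prop :=
  exists s : seq 'rV[rat]_n, basis_of B [seq map_mx ratr v | v <- s].

Definition rational_subspaces (e : nat) : set {vspace 'rV[R]_n} :=
  [set B | rational_subspace B /\ \dim B = e].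

Definition irrational_subspaces (d e j : nat) : set {vspace 'rV[R]_n} :=
  [set A | \dim A = d /\
    forall B, rational_subspaces e B -> (\dim (A :&: B) < j)%N].

(* The 'C(n, e) strictly increasing sequences of e indices among n. *)
Definition plucker_index (e : nat) : Type :=
  {f : {ffun 'I_e -> 'I_n} | [forall i : 'I_e, forall k : 'I_e, (i < k)%N ==> (f i < f k)%N]}.

(* Plucker coordinates are defined up to a nonzero factor: Xi is one choice of
   them when it is the vector of maximal minors of some basis of B. *)
Definition plucker_coords B (Xi : plucker_index (\dim B) -> R) : Prop :=
  exists M : 'M[R]_(\dim B, n),
    basis_of B [seq row i M | i <- enum 'I_(\dim B)] /\
    forall f, Xi f = \det (colsub (val f) M).

(* Meaningful for rational B, where the set below is a singleton, Xi being
   unique up to sign. *)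
Definition height B : R :=
  xget 0 [set h | exists Xi : plucker_index (\dim B) -> int,
    [/\ plucker_coords (fun f => (Xi f)%:~R),
        \big[gcdn/0%N]_f `|Xi f|%N = 1%N &
        h = Num.sqrt (\sum_f ((Xi f)%:~R) ^+ 2)]].

(* 0 is adjoined so that the supremum is taken in [0, +oo]. *)
Definition mu_exponent A (e j : nat) : \bar R :=
  ereal_sup (0%E |` [set b%:E | b in [set b : R | 0 < b /\
    infinite_set [set B | rational_subspaces e B /\
                          psi_ j A B <= height B `^ (- b)]]]).

End Rational.

Definition mu_inf (R : realType) (n d e j : nat) : \bar R :=
  ereal_inf [set mu_exponent A e j
            | A in @irrational_subspaces R n d e j].

(* Main.v *)
Require Import Defs.
From mathcomp Require Import all_boot all_order all_fingroup all_algebra.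
From mathcomp Require Import all_classical all_reals all_analysis.
From mathcomp Require Import zify ring.

(** Let n = 2d, let p be a prime >= n and t the real n-th root of p. The
    subspace A is the kernel of v |-> (sum_k k^i t^k v_k)_(i < d).
    If M is a d x n matrix whose maximal minors are setwise coprime integers,
    reduced echelon form modulo p turns the determinant of M times this map
    into a Vandermonde determinant of distinct residues modulo p, up to higher
    order terms for the p-adic valuation, so it is a nonzero element of Z[t].
    By Liouville's inequality it is >> H^(1-n), where H bounds the minors of M,
    whence psi_1(A, B) >> H(B)^(-n) for every rational B of dimension d.
    For dim B = l <= d, a pigeonhole argument (Schmidt's going-up) puts B in a
    rational subspace of dimension d and height << H(B)^((n-d)/(n-l)), hence
    psi_1(A, B) >> H(B)^(-2d^2/(2d-l)). Finally, only finitely many rational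
    subspaces have a given bound on their height. *)

Set Implicit Arguments.
Unset Strict Implicit.
Unset Printing Implicit Defensive.

Import Order.TTheory GRing.Theory Num.Theory numFieldNormedType.Exports.

Local Open Scope ring_scope.

(** * Maximal minors *)

(** Column selections are arbitrary maps, not only increasing ones, so that exchanging one index by
    [ffun_upd] stays in the same type. *)
Definition minor (R : pzRingType) (l n : nat) (M : 'M[R]_(l, n))
    (f : {ffun 'I_l -> 'I_n}) : R :=
  \det (colsub f M).

Definition ffun_upd (T : finType) (U : Type) (f : {ffun T -> U}) (j : T) (k : U) :
    {ffun T -> U} :=
  [ffun i => if i == j then k else f i].

(* When x lists the minors of M, this is adj(M_f) M: up to the factor x f, the
   matrix of the row space of M whose columns f form the identity. *)
Definition exchange_mx (R : Type) (l n : nat) (x : {ffun 'I_l -> 'I_n} -> R)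
    (f : {ffun 'I_l -> 'I_n}) : 'M[R]_(l, n) :=
  \matrix_(j, k) x (ffun_upd f j k).

Lemma ffun_upd_id (T : finType) (U : Type) (f : {ffun T -> U}) j : ffun_upd f j (f j) = f.
Proof. by apply/ffunP=> i; rewrite ffunE; case: eqP => [->|]. Qed.

Lemma minor_mulmx (R : comPzRingType) (l n : nat) (P : 'M[R]_l) (M : 'M[R]_(l, n))
    (f : {ffun 'I_l -> 'I_n}) :
  minor (P *m M) f = \det P * minor M f.
Proof. by rewrite /minor -det_mulmx; congr (\det _); apply/matrixP=> i j; rewrite !mxE;
  apply: eq_bigr => k _; rewrite mxE. Qed.

Lemma minor_eq0 (R : comPzRingType) (l n : nat) (M : 'M[R]_(l, n))
    (f : {ffun 'I_l -> 'I_n}) i j :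
  i != j -> f i = f j -> minor M f = 0.
Proof.
move=> neq efij; rewrite /minor -det_tr; apply: (determinant_alternate neq) => k.
by rewrite !mxE efij.
Qed.

(** Cramer's rule: entry (j, k) of the product is the cofactor expansion along column j of the minor
    in which that column is replaced by column k. *)
Lemma adj_colsub (R : comPzRingType) (l n : nat) (M : 'M[R]_(l, n)) (f : {ffun 'I_l -> 'I_n}) :
  \adj (colsub f M) *m M = exchange_mx (minor M) f.
Proof.
apply/matrixP=> j k; rewrite !mxE /minor (expand_det_col _ j).
apply: eq_bigr => i _; rewrite !mxE ffunE eqxx mulrC; congr (_ * _).
rewrite /cofactor; congr (_ * \det _); apply/matrixP=> a b; rewrite !mxE ffunE.
by rewrite eq_sym (negPf (neq_lift _ _)).
Qed.

(** Cauchy-Binet by multilinearity in the columns of the product, without grouping the maps [g] by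
    their image. *)
Lemma det_mulmx_minor (R : comPzRingType) (l n : nat) (M : 'M[R]_(l, n)) (N : 'M[R]_(n, l)) :
  \det (M *m N) = \sum_(g : {ffun 'I_l -> 'I_n}) (\prod_i N (g i) i) * minor M g.
Proof.
rewrite -det_tr trmx_mul /determinant.
under eq_bigr => s _.
  under eq_bigr => i _ do rewrite !mxE.
  rewrite bigA_distr_bigA /= mulr_sumr.
  over.
rewrite exchange_big /=; apply: eq_bigr => g _.
rewrite /minor -det_tr /determinant mulr_sumr; apply: eq_bigr => s _.
rewrite mulrCA; congr (_ * _); rewrite -big_split /=; apply: eq_bigr => i _.
by rewrite !mxE.
Qed.

Lemma ler_norm_det (R : numDomainType) (k : nat) (S : 'M[R]_k) (b : R) :
  (forall i j, `|S i j| <= b) -> `|\det S| <= k`!%:R * b ^+ k.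
Proof.
move=> Sb; rewrite /determinant (le_trans (ler_norm_sum _ _ _)) //.
apply: (@le_trans _ _ (\sum_(s : 'S_k) b ^+ k)).
  apply: ler_sum => s _; rewrite normrM normrX normrN1 expr1n mul1r.
  rewrite normr_prod -[k in b ^+ k]card_ord -prodr_const.
  by apply: ler_prod => i _; rewrite normr_ge0 Sb.
by rewrite sumr_const card_Sn mulr_natl.
Qed.

Lemma ler_norm_adj (R : numDomainType) (k : nat) (S : 'M[R]_k.+1) (b : R) :
  (forall i j, `|S i j| <= b) -> forall i j, `|(\adj S) i j| <= k`!%:R * b ^+ k.
Proof.
move=> Sb i j; rewrite mxE /cofactor normrM normrX normrN1 expr1n mul1r.
by apply: ler_norm_det => a c; rewrite !mxE.
Qed.

(** Congruence modulo [c] respects sums and products, hence the Leibniz formula. *)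
Lemma det_add_scale (R : comPzRingType) (k : nat) (A B : 'M[R]_k) (c : R) :
  exists q, \det (A + c *: B) = \det A + c * q.
Proof.
pose eqc x y := exists q : R, x = y + c * q.
have add x1 y1 x2 y2 : eqc x1 y1 -> eqc x2 y2 -> eqc (x1 + x2) (y1 + y2).
  by move=> [q1 ->] [q2 ->]; exists (q1 + q2); rewrite mulrDr addrACA.
have mul x1 y1 x2 y2 : eqc x1 y1 -> eqc x2 y2 -> eqc (x1 * x2) (y1 * y2).
  move=> [q1 ->] [q2 ->]; exists (q1 * y2 + y1 * q2 + c * (q1 * q2)).
  by rewrite !mulrDl !mulrDr !addrA -!mulrA [y1 * (c * q2)]mulrCA [q1 * (c * q2)]mulrCA;
    congr (_ + _); rewrite -!addrA; congr (_ + _); rewrite addrC.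
have refl x : eqc x x by exists 0; rewrite mulr0 addr0.
rewrite /determinant; apply: (big_ind2 eqc (refl 0) add) => s _; apply: (mul);
  first exact: refl.
by apply: (big_ind2 eqc (refl 1) mul) => i _; rewrite !mxE; exists (B i (s i)).
Qed.

(* S stands for multiplication by e on Z[theta], with u = (theta^i)_i. *)
Lemma det_le_eigenvalue (R : numDomainType) (k : nat) (S : 'M[R]_k.+1) (u : 'cV[R]_k.+1) (e
  b c : R) :
  S *m u = e *: u -> u 0 0 = 1 -> (forall i, `|u i 0| <= c) -> (forall i j, `|S i j| <= b) ->
  `|\det S| <= `|e| * (k.+1%:R * c * k`!%:R * b ^+ k).
Proof.
move=> Su u0 uc Sb.
(* Applying [\adj S] to the eigenvector equation gives [\det S *: u] on the left; coordinate 0,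
   where [u] is 1, is this identity. *)
have -> : \det S = e * \sum_j (\adj S) 0 j * u j 0.
  rewrite -[LHS]mulr1 -{1}u0; have /matrixP/(_ 0 0) := congr1 (mulmx (\adj S)) Su.
  by rewrite mulmxA mul_adj_mx mul_scalar_mx -scalemxAr !mxE.
rewrite normrM ler_wpM2l //; apply: le_trans (ler_norm_sum _ _ _) _.
apply: (@le_trans _ _ (\sum_(j < k.+1) (k`!%:R * b ^+ k * c))).
  by apply: ler_sum => j _; rewrite normrM ler_pM // ler_norm_adj.
by rewrite sumr_const card_ord -mulr_natl; rewrite le_eqVlt; apply/orP; left; apply/eqP; ring.
Qed.

Definition integral_minors (R : numDomainType) (l n : nat) (M : 'M[R]_(l, n))
  (Xi : {ffun 'I_l -> 'I_n} -> int) := forall f, minor M f = (Xi f)%:~R.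

Lemma exchange_mxE (R : numDomainType) (l n : nat) (M : 'M[R]_(l, n)) Xi f :
  integral_minors M Xi -> map_mx intr (exchange_mx Xi f) = \adj (colsub f M) *m M.
Proof. by move=> hXi; rewrite adj_colsub; apply/matrixP=> j k; rewrite !mxE hXi. Qed.

(** [\det (\adj S)] is the (l-1)-st power of [\det S]; the factor [Xi f] on the left avoids this
    truncated exponent. *)
Lemma minor_exchange_mx (R : numDomainType) (l n : nat) (M : 'M[R]_(l, n)) Xi f g :
  integral_minors M Xi -> minor (exchange_mx Xi f) g * Xi f = Xi f ^+ l * Xi g.
Proof.
move=> hXi; apply: (@intr_inj R); rewrite !rmorphM rmorphXn /= -!hXi.
rewrite /minor -det_map_mx map_mxsub (exchange_mxE f hXi).
rewrite -[X in X * _]/(minor (\adj (colsub f M) *m M) g) minor_mulmx.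
by rewrite mulrAC -det_mulmx mul_adj_mx det_scalar.
Qed.

(** * Non-vanishing modulo p *)

(* Th is nilpotent modulo p, so F(Th) is invertible modulo p as soon as F(0) is. *)
Lemma det_horner_mx_neq0 (m n p : nat) (Th : 'M[int]_m.+1) (F : {poly int}) :
  prime p -> Th ^+ n = p%:Z%:M -> ~~ (p%:Z %| F.[0])%Z -> \det (horner_mx Th F) != 0.
Proof.
move=> pp Thn pF.
have /factor_theorem [F1 eF] : root (F - F.[0]%:P) 0 by rewrite /root !hornerE subrr.
(* [K] is the geometric sum in the factorization of x^n - y^n with x = F(0) and y = -F1 X, so that x
   - y = F. At [Th], X^n becomes p, so the determinant of F(Th) divides an integer congruent to a
   power of F(0) modulo p. *)
have [K eK] : exists K, F * K = (F.[0] ^+ n)%:P - 'X^n * (- F1) ^+ n.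
  exists (\sum_(i < n) F.[0]%:P ^+ (n.-1 - i) * (- (F1 * 'X)) ^+ i).
  rewrite -[F in F * _](subrK F.[0]%:P) eF polyC0 subr0 addrC -{1}[F1 * 'X]opprK -subrXX.
  by rewrite rmorphXn /= -mulNr exprMn [_ * 'X^n]mulrC.
have := congr1 (horner_mx Th) eK.
rewrite rmorphB !rmorphM /= horner_mx_C !rmorphXn /= horner_mx_X Thn.
rewrite -!mulmxE mul_scalar_mx -scalerN => /(congr1 determinant).
rewrite det_mulmx => e; apply/negP => /eqP d0.
have [q eq] := det_add_scale (F.[0] ^+ n)%:M (- horner_mx Th (- F1) ^+ n) p%:Z.
move: e; rewrite d0 mul0r -rmorphXn {}eq det_scalar -exprM => /esym/eqP;
  rewrite addr_eq0 => /eqP e.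
have : (p%:Z %| F.[0] ^+ (n * m.+1))%Z by rewrite e dvdzE abszN -dvdzE dvdz_mulr.
rewrite dvdzE abszX Euclid_dvdX // => /andP[].
by rewrite -[(_ %| _)%N]/(p%:Z %| _)%Z (negPf pF).
Qed.

(* Column i is the i-th iterate of X d/dX applied to (1, X, ..., X^(n-1)). *)
Definition euler_mx (n d : nat) : 'M[{poly int}]_(n, d) :=
  \matrix_(k, i) ((k ^ i)%N%:R *: 'X^k).

(** By [det_mulmx_minor], the determinant of M times [euler_mx] for any M with minors [Xi]; written
    through the minors, it has integer coefficients. *)
Definition euler_form (n d : nat) (Xi : {ffun 'I_d -> 'I_n} -> int) : {poly int} :=
  \sum_(g : {ffun 'I_d -> 'I_n}) (\prod_i euler_mx n d (g i) i) * (Xi g)%:P.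

(* With f of least sum among the index sets whose minor is prime to p, the exchange
   matrix T is in echelon form modulo p: T j k is divisible by p for k < f j. Trading
   p for X^n, row j of T * euler_mx is X^(f j) times a row of G, where G(0) is, up to
   the factor Xi f, the Vandermonde matrix of the f j. *)
Lemma det_horner_euler_neq0 (R : numDomainType) (m n d p : nat) (Th : 'M[int]_m.+1)
    (M : 'M[R]_(d, n)) (Xi : {ffun 'I_d -> 'I_n} -> int) (f0 : {ffun 'I_d -> 'I_n}) :
  prime p -> (0 < n <= p)%N -> Th ^+ n = p%:Z%:M -> integral_minors M Xi ->
  ~~ (p%:Z %| Xi f0)%Z -> \det (horner_mx Th (euler_form Xi)) != 0.
Proof.
move=> pp /andP[n0 np] Thn hXi hf0.
have [f pf fmin] := @arg_minnP _ f0 (fun f => ~~ (p%:Z %| Xi f)%Z) (fun f : {ffun 'I_d ->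
  'I_n} => \sum_j f j)%N hf0.
set a := Xi f in pf.
have a0 : a != 0 by apply: contraNneq pf => ->; rewrite dvdz0.
pose T := exchange_mx Xi f.
(* Replacing [f j] by a smaller [k] lowers the sum of the indices, so minimality of [f] makes p
   divide the new minor. *)
have Tlt (j : 'I_d) (k : 'I_n) : (k < f j)%N -> (p %| Xi (ffun_upd f j k))%Z.
  move=> kf; apply: contraLR kf => /fmin; rewrite -leqNgt.
  have -> : (\sum_i ffun_upd f j k i = k + \sum_(i | i != j) f i)%N.
    rewrite (bigD1 j) //= ffunE eqxx; congr addn; apply: eq_bigr => i /negPf ij.
    by rewrite ffunE ij.
  by rewrite (bigD1 j) //= leq_add2r.
have finj : injective (f : {ffun 'I_d -> 'I_n}).
  move=> i j fij; apply/eqP; apply: contraNT a0 => /minor_eq0/(_ fij).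
  by move/(_ _ M); rewrite hXi => /eqP; rewrite intr_eq0.
(* Where [k < f j], a factor p of [T j k] is replaced by X^n, so that X^(f j) can be divided out;
   [q] times [Q] is the error made. *)
pose G := \matrix_(j < d, i < d) \sum_(k < n)
  (if (k < f j)%N then ((T j k %/ p)%Z * (k ^ i)%N%:R) *: 'X^(n + k - f j)
   else (T j k * (k ^ i)%N%:R) *: 'X^(k - f j)) : 'M[{poly int}]_d.
pose Q := \matrix_(j < d, i < d) \sum_(k < n | (k < f j)%N)
  (((T j k %/ p)%Z * (k ^ i)%N%:R) *: 'X^k : {poly int}).
pose q : {poly int} := 'X^n - p%:Z%:P.
have eTD : map_mx polyC T *m euler_mx n d =
    diag_mx (\row_j 'X^(f j)) *m G + q *: (- Q).
  apply/matrixP=> j i; rewrite [LHS]mxE mul_diag_mx !mxE mulr_sumr mulrN.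
  rewrite mulr_sumr [X in _ - X]big_mkcond -sumrB; apply: eq_bigr => k _.
  rewrite !mxE mul_polyC; case: ltnP => kf.
    rewrite scalerA -!scalerAr -scalerBr -exprD subnKC; last by rewrite ltnW // ltn_addr.
    rewrite mulrBl exprD opprB addrCA subrr addr0 mul_polyC scalerA.
    by rewrite mulrAC divzK // Tlt.
  by rewrite subr0 scalerA -scalerAr -exprD subnKC.
(* At 0 only the term [k = f j] survives, with coefficient [a]: for [k < f j] the exponent n + k - f
   j is positive because f j < n. *)
have detG : (\det G).[0] = a ^+ d * \det (Vandermonde d (\row_j (f j)%:R)).
  rewrite -[_.[0]]/(horner_eval 0 (\det G)) -det_map_mx -detZ -[in RHS]det_tr.
  congr (\det _); apply/matrixP=> j i; rewrite !mxE rmorph_sum /=.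
  rewrite (bigD1 (f j)) //= ltnn subnn expr0 /horner_eval hornerZ hornerC mulr1 mxE
    ffun_upd_id.
  rewrite natrX big1 ?addr0 // => k kf; case: ltnP => [lt|le].
    rewrite hornerZ hornerXn expr0n subn_eq0 leqNgt.
    by rewrite (leq_trans (ltn_ord (f j))) ?leq_addr ?mulr0.
  rewrite hornerZ hornerXn expr0n subn_eq0 leq_eqVlt ltnNge le orbF.
  by rewrite -[_ == _ :> nat]/(k == f j) (negPf kf) mulr0.
(* The Vandermonde factors are differences of distinct integers in [0, n), and n <= p. *)
have pG : ~~ (p%:Z %| (\det G).[0])%Z.
  pose N x := ~~ (p%:Z %| x)%Z.
  have NM x y : N x -> N y -> N (x * y).
    by rewrite /N !dvdzE abszM Euclid_dvdM // negb_or => -> ->.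
  have N1 : N 1 by rewrite /N dvdzE /= gtnNdvd // prime_gt1.
  rewrite -[~~ _]/(N _) detG det_Vandermonde -[d in a ^+ d]card_ord -prodr_const.
  apply: (NM); first by apply: (big_ind N) => // i _.
  apply: (big_ind N) => // i _; apply: (big_ind N) => // j ij.
  rewrite /N !mxE !natz -eqz_mod_dvd !modz_small ?lez_nat ?ltz_nat ?(leq_trans (ltn_ord _)) //.
  by apply: contraL ij => /eqP[/val_inj/finj->]; rewrite ltnn.
have qTh : horner_mx Th q = 0.
  by rewrite rmorphB /= rmorphXn /= horner_mx_X horner_mx_C Thn subrr.
have [Q' eQ] := det_add_scale (diag_mx (\row_j 'X^(f j)) *m G) (- Q) q.
have eE : a *: \det (map_mx polyC T *m euler_mx n d) = a ^+ d *: euler_form Xi.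
  rewrite det_mulmx_minor !scaler_sumr; apply: eq_bigr => g _.
  rewrite !scalerAr; congr (_ * _); rewrite -!mul_polyC -!polyCM /minor -map_mxsub.
  by rewrite det_map_mx -polyCM -(minor_exchange_mx f g hXi) mulrC.
apply/negP=> /eqP d0.
have := congr1 (fun P => \det (horner_mx Th P)) eE.
rewrite eTD eQ -!mul_polyC rmorphM rmorphD !rmorphM /= !horner_mx_C qTh mul0r addr0.
rewrite -!mulmxE !det_mulmx d0 mulr0 det_diag rmorphM rmorph_prod /= -mulmxE !det_mulmx.
move/eqP; rewrite !mulf_eq0 det_scalar expf_eq0 (negPf a0) andbF /=.
rewrite (negPf (det_horner_mx_neq0 pp Thn pG)) orbF.
(* There remains the diagonal factor, a product of powers of [Th], which is nonsingular because
   [Th ^+ n] is the scalar p. *)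
apply/negP; apply: (big_ind (fun A : 'M[int]_m.+1 => \det A != 0)).
- by rewrite det1 oner_eq0.
- by move=> A B A0 B0; rewrite -[\det _]/(\det (A *m B)) det_mulmx mulf_neq0.
move=> j _; rewrite mxE rmorphXn /= horner_mx_X.
have Th0 : \det Th != 0.
  apply: contra_neq (_ : \det (Th ^+ n) != 0) => [Th0|].
    by rewrite -(prednK n0) exprS -mulmxE det_mulmx Th0 mul0r.
  by rewrite Thn det_scalar expf_neq0 // eqz_nat -lt0n prime_gt0.
elim: (f j : nat) => [|k IH]; first by rewrite expr0 det1 oner_eq0.
by rewrite exprS -mulmxE det_mulmx mulf_neq0.
Qed.

(** * Liouville inequality *)

(* Multiplication by the (n+1)-st root of p, in the basis of its powers. *)
Definition root_mx (n : nat) (p : int) : 'M[int]_n.+1 :=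
  \matrix_(i, j) if i == n :> nat then p * (j == 0 :> nat)%:R else (i.+1 == j :> nat)%:R.

Lemma root_mxX (n : nat) (p : int) : root_mx n p ^+ n.+1 = p%:M.
Proof.
set Th := root_mx n p.
(* The first unit row vector is cyclic: powers of [Th] carry it through the standard basis. As
   [Th ^+ n.+1] commutes with them, its value on this vector determines it. *)
have e0 k : (k < n.+1)%N -> delta_mx 0 0 *m Th ^+ k = delta_mx 0 (inord k) :> 'rV_n.+1.
  elim: k => [|k IH] kn.
    by rewrite expr0 mulmx1; congr delta_mx; apply/val_inj; rewrite /= inordK.
  rewrite exprSr -mulmxE mulmxA IH ?(ltnW kn) // -rowE.
  apply/matrixP=> i j; rewrite !mxE inordK ?(ltnW kn) // ord1 /=.
  rewrite -val_eqE /= inordK // [X in if X then _ else _]ltn_eqF //.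
  by rewrite eq_sym.
have e0n : delta_mx 0 0 *m Th ^+ n.+1 = p *: delta_mx 0 0 :> 'rV_n.+1.
  rewrite exprSr -mulmxE mulmxA e0 // -rowE.
  by apply/matrixP=> i j; rewrite !mxE inordK // eqxx ord1.
apply/row_matrixP=> i; rewrite [LHS]rowE -[i]inord_val -e0 // -mulmxA.
have -> : Th ^+ i *m Th ^+ n.+1 = Th ^+ n.+1 *m Th ^+ i.
  by rewrite mulmxE -!exprD addnC.
by rewrite mulmxA e0n -scalemxAl e0 // [RHS]rowE mul_mx_scalar.
Qed.

Lemma root_mx_eigen (R : comNzRingType) (n : nat) (p : int) (t : R) (P : {poly int}) :
  t ^+ n.+1 = p%:~R ->
  map_mx intr (horner_mx (root_mx n p) P) *m (\col_(i < n.+1) t ^+ i) =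
  (map_poly intr P).[t] *: (\col_(i < n.+1) t ^+ i).
Proof.
move=> tn; set u := \col_i _.
have Thu : map_mx intr (root_mx n p) *m u = t *: u.
  apply/matrixP=> i j; rewrite !mxE -exprS.
  case: (eqVneq (i : nat) n) => [ein | nin].
    rewrite (bigD1 0) //= big1 => [|k k0].
      by rewrite !mxE ein !eqxx !mulr1 addr0 tn.
    have /negPf k0' : (k != 0 :> nat) by [].
    by rewrite !mxE ein eqxx k0' mulr0 mul0r.
  have lin : (i.+1 < n.+1)%N by rewrite ltn_neqAle eqSS nin ltn_ord.
  rewrite (bigD1 (Ordinal lin)) //= big1 => [|k k0].
    by rewrite !mxE (negPf nin) eqxx mul1r addr0.
  rewrite !mxE (negPf nin) -[_ == _ :> nat]/(Ordinal lin == k) eq_sym (negPf k0).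
  by rewrite mul0r.
elim/poly_ind: P => [|P c IH].
  by rewrite !rmorph0 horner0 mul0mx scale0r.
rewrite !rmorphD !rmorphM /= horner_mx_X horner_mx_C map_polyX map_polyC /= !hornerE.
rewrite -mulmxE mulmxDl -mulmxA Thu -scalemxAr IH map_scalar_mx mul_scalar_mx.
by rewrite scalerDl scalerA mulrC.
Qed.

Definition euler_eval (R : pzRingType) (n d : nat) (t : R) : 'M[R]_(n, d) :=
  \matrix_(k, i) ((k ^ i)%:R * t ^+ k).

Lemma det_euler_eval (R : numDomainType) (n d : nat) (t : R) (M : 'M[R]_(d, n)) Xi :
  integral_minors M Xi ->
  \det (M *m euler_eval n d t) = (map_poly intr (euler_form Xi)).[t].
Proof.
move=> hXi; rewrite det_mulmx_minor rmorph_sum /= horner_sum; apply: eq_bigr => g _.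
rewrite rmorphM rmorph_prod /= map_polyC hornerM hornerC hXi horner_prod.
congr (_ * _); apply: eq_bigr => i _; rewrite !mxE map_polyZ map_polyXn hornerZ hornerXn.
by rewrite rmorph_nat.
Qed.

(** Multiplication by the determinant e on Z[t] is an integer matrix [S] with nonzero determinant,
    so [|\det S|] is at least 1. The entries of [S] are O(mu) and e is an eigenvalue, so [|\det S|]
    is O(|e| mu^n). *)
Lemma det_euler_eval_ge (R : realFieldType) (n d p : nat) (t : R) :
  prime p -> (n < p)%N -> t ^+ n.+1 = p%:R ->
  exists2 c : R, 0 < c & forall (M : 'M[R]_(d, n.+1)) Xi f0 mu,
    integral_minors M Xi -> ~~ (p%:Z %| Xi f0)%Z -> (forall f, `|minor M f| <= mu) ->
    c <= `|\det (M *m euler_eval n.+1 d t)| * mu ^+ n.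
Proof.
move=> pp np tn; pose Th := root_mx n p%:Z.
pose B (g : {ffun 'I_d -> 'I_n.+1}) : 'M[R]_n.+1 :=
  map_mx intr (horner_mx Th (\prod_i euler_mx n.+1 d (g i) i)).
pose C := 1 + \sum_g \sum_i \sum_j `|B g i j|.
pose U := 1 + \sum_(i < n.+1) `|t ^+ i|.
have C0 : 0 < C.
  by rewrite ltr_wpDr // sumr_ge0 // => ? _; rewrite sumr_ge0 // => ? _; rewrite sumr_ge0.
have U0 : 0 < U by rewrite ltr_wpDr // sumr_ge0.
exists (n.+1%:R * U * n`!%:R * C ^+ n)^-1.
  by rewrite invr_gt0 !mulr_gt0 ?exprn_gt0 ?ltr0n ?fact_gt0.
move=> M Xi f0 mu hXi hf0 hmu.
have mu0 : 0 <= mu by apply: le_trans (hmu f0).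
have Thn : Th ^+ n.+1 = p%:Z%:M by apply: root_mxX.
have d0 := det_horner_euler_neq0 pp (np : (0 < n.+1 <= p)%N) Thn hXi hf0.
set S : 'M[R]_n.+1 := map_mx intr (horner_mx Th (euler_form Xi)).
have Sb i j : `|S i j| <= C * mu.
  have -> : S i j = \sum_g B g i j * minor M g.
    rewrite mxE /euler_form rmorph_sum summxE rmorph_sum /=; apply: eq_bigr => g _.
    rewrite rmorphM /= horner_mx_C -mulmxE mul_mx_scalar mxE rmorphM /= mulrC hXi.
    by congr (_ * _); rewrite mxE.
  apply: le_trans (ler_norm_sum _ _ _) _.
  apply: (@le_trans _ _ (\sum_g `|B g i j| * mu)).
    by apply: ler_sum => g _; rewrite normrM ler_wpM2l.
  rewrite -mulr_suml ler_wpM2r // ler_wpDl // ler_sum // => g _.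
  rewrite (bigD1 i) //= (bigD1 j) //= -addrA lerDl addr_ge0 ?sumr_ge0 // => k _.
  by rewrite sumr_ge0.
have := det_le_eigenvalue (root_mx_eigen (euler_form Xi) (tn : t ^+ n.+1 = p%:Z%:~R)).
rewrite -/Th -/S => /(_ (C * mu) U) H.
have {}H : `|\det S| <= `|(map_poly intr (euler_form Xi)).[t]| * (n.+1%:R * U * n`!%:R * (C
  * mu) ^+ n).
  apply: H => //; first by rewrite mxE expr0.
  move=> i; rewrite mxE ler_wpDl // (bigD1 i) //= lerDl sumr_ge0 //.
rewrite (det_euler_eval _ hXi); set e := `|_| in H *.
rewrite -[_^-1]mulr1 ler_pdivrMl ?mulr_gt0 ?exprn_gt0 ?ltr0n ?fact_gt0 //.
have S1 : 1 <= `|\det S|.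
  by rewrite /S det_map_mx -intr_norm (ler_int _ 1) -gtz0_ge1 normr_gt0.
by apply: le_trans S1 (le_trans H _); rewrite exprMn le_eqVlt; apply/orP; left; apply/eqP;
  ring.
Qed.

(** * Going up *)

Lemma bezout_family (I : finType) (x : I -> int) :
  exists (g : nat) (u : I -> int), \sum_i u i * x i = g /\ forall i, (g%:Z %| x i)%Z.
Proof.
suff [g [u [gu gx]]] : exists (g : nat) (u : I -> int),
    \sum_i u i * x i = g /\ forall i, i \in enum I -> (g%:Z %| x i)%Z.
  by exists g, u; split=> // i; rewrite gx // mem_enum.
elim: (enum I) => [|i s [g [u [gu gx]]]].
  by exists 0%N, (fun=> 0); split=> //; rewrite big1 // => i _; rewrite mul0r.
have [v [w vw]] := Bezoutz (x i) g.
exists (gcdn `|x i| g), (fun k => v * (k == i)%:R + w * u k); split=> [|k].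
  under eq_bigr => k _ do rewrite mulrDl -!mulrA.
  rewrite big_split /= -!mulr_sumr gu (bigD1 i) //= eqxx mul1r big1 ?addr0 ?vw //.
  by move=> k /negPf ->; rewrite mul0r.
rewrite inE => /predU1P[->|/gx]; first exact: (dvdz_gcdl (x i) g%:Z).
by apply: dvdz_trans; apply: (dvdz_gcdr (x i) g%:Z).
Qed.

(* The integral minors generate the unit ideal, i.e. are setwise coprime. *)
Definition primitive (R : numDomainType) (l n : nat) (M : 'M[R]_(l, n)) :=
  exists Xi, integral_minors M Xi /\ exists u, \sum_f u f * Xi f = 1.

(** The factor [t] is put into the first row alone. *)
Lemma scale_minors (F : fieldType) (l n : nat) (M : 'M[F]_(l, n)) (t : F) :
  (0 < l)%N -> t != 0 ->
  exists M' : 'M[F]_(l, n), (M' :=: M)%MS /\ forall f, minor M' f = t * minor M f.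
Proof.
case: l M => // l M _ t0; pose P : 'M[F]_l.+1 := diag_mx (\row_i if i == 0 then t else 1).
have dP : \det P = t.
  rewrite det_diag (bigD1 0) //= mxE eqxx big1 ?mulr1 // => i /negPf i0.
  by rewrite mxE i0.
exists (P *m M); split=> [|f]; last by rewrite minor_mulmx dP.
by apply: eqmxMfull; rewrite row_full_unit unitmxE dP unitfE.
Qed.

Lemma primitive_of_integral (R : numFieldType) (l n : nat) (M : 'M[R]_(l, n)) Xi f0 :
  (0 < l)%N -> integral_minors M Xi -> Xi f0 != 0 ->
  exists M' : 'M[R]_(l, n), [/\ (M' :=: M)%MS, primitive M' &
    forall f, `|minor M' f| <= `|minor M f|].
Proof.
move=> l0 hXi f00; have [g [u [gu gx]]] := bezout_family Xi.
have g0 : g != 0%N by apply: contraNneq f00 => g0; have := gx f0; rewrite g0 dvd0z.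
have gR : g%:R != 0 :> R by rewrite pnatr_eq0.
have [M' [eM mM]] := scale_minors M l0 (invr_neq0 gR).
have hXi' : integral_minors M' (fun f => (Xi f %/ g)%Z).
  move=> f; rewrite mM hXi -{1}(divzK (gx f)) rmorphM /= mulrC -mulrA.
  by rewrite (_ : g%:~R = g%:R :> R) // mulfV ?mulr1.
exists M'; split=> // [|f].
  exists (fun f => (Xi f %/ g)%Z); split=> //; exists u.
  apply: (@mulIf _ g%:Z); first by rewrite eqz_nat.
  rewrite mul1r mulr_suml -[RHS]gu; apply: eq_bigr => f _.
  by rewrite -mulrA (divzK (gx f)).
rewrite mM normrM normfV ler_piMl // invf_le1 ?normr_gt0 // ger0_norm ?ler0n //.
by rewrite ler1n lt0n.
Qed.

(* The z T mod a, for z in a fundamental domain of the lattice {z | z T = 0 mod a},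
   are distinct; prim makes the index of this lattice (the product of the q j, the
   diagonal of a triangular basis) at least |a|, so two of them share a box of side
   |a| / K. *)
Lemma small_residue (l n : nat) (T : 'M[int]_(l, n)) (a : int) (f : 'I_l -> 'I_n) (K : nat) :
  injective f -> (forall i j, T i (f j) = a *+ (i == j)) ->
  (forall Z : 'M[int]_l, (forall j k, (a %| (Z *m T) j k)%Z) -> (a %| \det Z)%Z) ->
  a != 0 -> (0 < K)%N -> (K ^ (n - l) < `|a|)%N ->
  exists (z : 'rV[int]_l) (w : 'rV[int]_n), let y := z *m T - a *: w in
    [/\ y != 0, forall i, y 0 (f i) = 0 & forall k, `|y 0 k| * K%:Z <= `|a|].
Proof.
move=> finj Tf prim a0 K0 Ka.
pose L (z : 'rV[int]_l) := forall k, (a %| (z *m T) 0%R k)%Z.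
pose tail j (z : 'rV[int]_l) := forall i : 'I_l, (j < i)%N -> z 0 i = 0.
(* Triangular basis: for each [j], a lattice vector with no coordinate after [j] and the smallest
   positive [j]-th coordinate. *)
have /fin_all_exists [qz hqz] : forall j : 'I_l, exists qz : nat * 'rV[int]_l,
    [/\ (0 < qz.1)%N, qz.2 0 j = qz.1, tail j qz.2, L qz.2 &
    forall z, tail j z -> L z -> 0 < z 0 j -> qz.1%:Z <= z 0 j].
  move=> j; pose P q := `[< (0 < q)%N /\ exists z : 'rV[int]_l,
    [/\ z 0 j = q%:Z, tail j z & L z] >].
  have exP : exists q, P q.
    exists `|a|%N; apply/asboolP; split; first by rewrite absz_gt0.
    exists (`|a| *: delta_mx 0 j); split=> [|i ji|k].
    - by rewrite !mxE !eqxx mulr1 abszE.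
    - by rewrite !mxE eqxx -val_eqE /= gtn_eqF // mulr0.
    by rewrite -scalemxAl mxE dvdz_mulr // dvdzE absz_id.
  case: (ex_minnP exP) => q /asboolP[q0 [z [zj tz Lz]]] qmin.
  exists (q, z); split=> // z' tz' Lz' z'0.
  suff /qmin : P (absz (z' 0 j)) by rewrite -lez_nat gtz0_abs.
  apply/asboolP; split; first by rewrite absz_gt0 gt_eqF.
  by exists z'; split=> //; rewrite gtz0_abs.
pose q j := (qz j).1.
have aq : (`|a| <= \prod_j q j)%N.
  apply: dvdn_leq; first by rewrite prodn_gt0 // => j; have [] := hqz j.
  pose Z : 'M[int]_l := \matrix_j (qz j).2.
  have -> : (\prod_j q j)%N = `|\det Z|%N.
    rewrite det_trig; last first.
      by apply/is_trig_mxP=> i j ij; rewrite mxE; have [_ _ /(_ j ij)] := hqz i.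
    by rewrite (big_morph absz abszM (erefl (absz 1))); apply: eq_bigr => j _; rewrite mxE;
      have [_ ->] := hqz j.
  apply: prim => j k; have [_ _ _ /(_ k) + _] := hqz j.
  by congr (_ %| _)%Z; rewrite !mxE; apply: eq_bigr => i _; rewrite mxE.
case: K K0 Ka => // K _ Ka.
pose N := (\max_j q j)%N.
(* [A] is the fundamental box, with at least |a| points. Below, [h] records in which of [K.+1]
   subintervals each residue outside the columns [f] lies; residues in the columns [f] are 0. *)
pose A := [set x in family (fun j : 'I_l => [pred x : 'I_N.+1 | (x < q j)%N])].
have cA : #|A| = (\prod_j q j)%N.
  rewrite cardsE card_family foldrE big_map enumT; apply: eq_bigr => j _.
  rewrite -sum1_card -(big_ord_widen N.+1 (fun=> 1%N)) ?sum1_card ?card_ord //.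
  by rewrite ltnW // ltnS leq_bigmax.
pose zv (x : {ffun 'I_l -> 'I_N.+1}) : 'rV[int]_l := \row_j (x j)%:Z.
pose r x k := absz (((zv x *m T) 0%R k) %% a)%Z.
have ra x k : (r x k < `|a|)%N.
  by rewrite -ltz_nat /r gez0_abs ?modz_ge0 // abszE ltz_mod.
pose h x := [ffun k : {k | k \notin codom f} => inord (r x (val k) * K.+1 %/ `|a|) : 'I_K.+1].
have [/dinjectiveP hinj | /dinjectivePn[x xA [x' x'A hx]]] := boolP (dinjectiveb h A).
  have := leq_trans Ka aq; rewrite -cA -(card_in_imset hinj) => /leq_trans/(_ (max_card _)).
  rewrite card_ffun card_ord card_sig.
  have := cardC [in codom f]; rewrite (card_codom finj : #|[in codom f]| = _) !card_ord => cf.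
  rewrite -(eq_card (_ : [predC [in codom f]] =i _)) // -[n in (n - l)%N]cf addKn.
  by rewrite ltnn.
exists (zv x - zv x').
(* The difference of the quotients by [a], which makes [y] the difference of the two residue
   vectors. *)
exists (\row_k (((zv x *m T) 0%R k %/ a)%Z - ((zv x' *m T) 0%R k %/ a)%Z)) => y.
have ey k : y 0 k = (r x k)%:Z - (r x' k)%:Z.
  rewrite /r !gez0_abs ?modz_ge0 // /modz /y mulmxBl.
  have mxB (B C : 'rV[int]_n) : (B - C) 0 k = B 0 k - C 0 k by rewrite !mxE.
  by rewrite !mxB [X in _ - X]mxE [X in _ * X]mxE; ring.
have rf x0 i : r x0 (f i) = 0%N.
  rewrite /r; apply/eqP; rewrite absz_eq0; apply/eqP/dvdz_mod0P.
  rewrite mxE (bigD1 i) //= Tf eqxx big1 ?addr0 ?dvdz_mull // => j ji.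
  by rewrite Tf (negPf ji) mulr0.
split=> [|i|k].
(* If [y] were 0, [x - x'] would lie in the lattice; at the last index [i] where they differ, the
   difference is smaller than [q i] in absolute value, against minimality. *)
- have xlt (x0 : {ffun 'I_l -> 'I_N.+1}) i : x0 \in A -> (x0 i < q i)%N.
    by rewrite inE => /familyP/(_ i).
  move: x'A => /andP[x'x x'A]; apply/negP=> /eqP y0.
  have Lx : L (zv x - zv x').
    by move=> k; have /eqP := y0; rewrite /y subr_eq0 => /eqP->; rewrite mxE dvdz_mulr.
  have [i0 hi0] : exists i, x i != x' i.
    apply/existsP; apply: contraNT x'x; rewrite negb_exists => /forallP e.
    by apply/eqP/ffunP=> i; apply/esym/eqP; have := e i; rewrite negbK.
  have [i hi imax] := @arg_maxnP _ i0 (fun i => x i != x' i) (fun i => i : nat) hi0.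
  have Tx : tail i (zv x - zv x').
    move=> j ij; rewrite !mxE; apply/eqP; rewrite subr_eq0 eqz_nat.
    by apply: contraLR ij => /imax; rewrite -leqNgt.
  have [_ _ _ _ qmin] := hqz i.
  move: hi (xlt x i xA) (xlt x' i x'A); rewrite -val_eqE neq_ltn /q => /orP[] xx lt1 lt2.
    have Ty : tail i (- (zv x - zv x')) by move=> j /Tx e; rewrite mxE e oppr0.
    have Ly : L (- (zv x - zv x')) by move=> k; rewrite mulNmx mxE dvdzE abszN -dvdzE;
      apply: Lx.
    have := qmin _ Ty Ly; rewrite !mxE.
    move: xx => /= xx; lia.
  by have := qmin _ Tx Lx; rewrite !mxE; move: xx => /= xx; lia.
- by rewrite ey !rf subrr.
have [/codomP[i ->]|kf] := boolP (k \in codom f); first by rewrite ey !rf subrr normr0 mul0r.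
have /ffunP/(_ (exist _ k kf)) := hx; rewrite !ffunE => /(congr1 val) /=.
have a0' : (0 < `|a|)%N by rewrite absz_gt0.
have rK x0 : (r x0 k * K.+1 %/ `|a| < K.+1)%N by rewrite ltn_divLR // mulnC ltn_pmul2l ?ra.
rewrite !inordK //.
rewrite ey; move: (ra x k) (ra x' k); move: (r x k) (r x' k) => u v ua va.
have := ltn_pmod (u * K.+1) a0'; have := ltn_pmod (v * K.+1) a0'.
have := divn_eq (u * K.+1) `|a|; have := divn_eq (v * K.+1) `|a|.
move: (_ %/ _)%N (_ %/ _)%N (_ %% _)%N (_ %% _)%N => c1 c2 m1 m2 e1 e2 lt1 lt2 c12.
rewrite -[(K.+1)%:Z]ger0_norm // -normrM mulrBl -!PoszM e1 e2 c12 -abszE.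
move: (c1 * `|a|)%N (absz a) lt1 lt2 => C1 b lt1 lt2; lia.
Qed.

Lemma minor_col_mx (R : comPzRingType) (l n : nat) (v : 'rV[R]_n) (M : 'M[R]_(l, n))
    (g : {ffun 'I_l.+1 -> 'I_n}) :
  minor (col_mx v M : 'M[R]_(l.+1, n)) g =
  \sum_j v 0 (g j) * ((-1) ^+ j * minor M [ffun i => g (lift j i)]).
Proof.
rewrite /minor (expand_det_row _ ord0); apply: eq_bigr => j _.
rewrite mxE (_ : ord0 = lshift l (0 : 'I_1)); last exact/val_inj.
rewrite (col_mxEu v M 0).
rewrite /cofactor add0n; congr (_ * (_ * \det _)); apply/matrixP=> a b; rewrite !mxE ffunE.
have -> : lift (lshift l (0 : 'I_1)) a = rshift 1 a by apply/val_inj.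
by case: splitP => [i|i]; rewrite /= ?ord1 //= add1n => -[/val_inj->].
Qed.

Lemma minor_col_mx_mul (R : comPzRingType) (l n : nat) (c : 'rV[R]_l) (M : 'M[R]_(l, n)) g :
  minor (col_mx (c *m M) M : 'M[R]_(l.+1, n)) g = 0.
Proof.
have -> : col_mx (c *m M) M = block_mx (1%:M : 'M[R]_1) c 0 1%:M *m col_mx 0 M.
  by rewrite mul_block_col mulmx0 !mul1mx add0r mul0mx add0r.
rewrite (minor_mulmx (block_mx (1%:M : 'M[R]_1) c 0 1%:M : 'M[R]_l.+1)) minor_col_mx.
by rewrite big1 ?mulr0 // => j _; rewrite mxE mul0r.
Qed.

Lemma primitive_neq0 (R : numDomainType) (l n : nat) (M : 'M[R]_(l, n)) :
  primitive M -> exists Xi f, [/\ integral_minors M Xi, Xi f != 0 & forall g, `|Xi g| <=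
    `|Xi f|].
Proof.
move=> [Xi [hXi [u hu]]].
have [f0 hf0] : exists f0, Xi f0 != 0.
  apply/existsP; apply: contra_eqT hu; rewrite negb_exists => /forallP e.
  by rewrite big1 // => f _; have := e f; rewrite negbK => /eqP->; rewrite mulr0.
exists Xi; have [f _ fmax] := @arg_maxnP _ f0 xpredT (fun f => absz (Xi f)) isT.
have {}fmax g : `|Xi g| <= `|Xi f| by rewrite -!abszE lez_nat; apply: fmax.
exists f; split=> //; by rewrite -normr_gt0 (lt_le_trans _ (fmax f0)) ?normr_gt0.
Qed.

Lemma integral_minor_inj (R : numDomainType) (l n : nat) (M : 'M[R]_(l, n)) Xi f :
  integral_minors M Xi -> Xi f != 0 -> injective f.
Proof.
move=> hXi a0 i j fij; apply/eqP; apply: contraNT a0 => ij.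
have := @minor_eq0 _ _ _ M f i j ij fij.
by rewrite hXi => /eqP; rewrite intr_eq0.
Qed.

(* K is about |a|^(1/(n-l)) for a maximal minor a; the new row w lies within 1/K of
   the row space of M, so the minors are multiplied by O(1/K). *)
Lemma extend_primitive (R : realFieldType) (l n : nat) : (l < n)%N ->
  exists2 C : R, 0 < C & forall (M : 'M[R]_(l, n)) (mu : R),
    primitive M -> (forall f, `|minor M f| <= mu) ->
    exists (M' : 'M[R]_(l.+1, n)) (mu' : R),
      [/\ (M <= M')%MS, primitive M', forall f, `|minor M' f| <= mu' &
          mu' ^+ (n - l) <= C * mu ^+ (n - l).-1].
Proof.
move=> ln; set r := (n - l)%N; have r0 : (0 < r)%N by rewrite subn_gt0.
exists ((2 * l.+1%:R) ^+ r) => [|M mu pM hmu]; first by rewrite exprn_gt0 ?mulr_gt0 ?ltr0n.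
have [Xi [f [hXi a0 fmax]]] := primitive_neq0 pM; set a := Xi f in a0 fmax.
have finj := integral_minor_inj hXi a0.
pose T := exchange_mx Xi f.
have Tf i j : T i (f j) = a *+ (i == j).
  rewrite mxE; case: eqVneq => [->|ij]; first by rewrite ffun_upd_id.
  apply: (@intr_inj R); rewrite -hXi; apply: (minor_eq0 _ ij).
  by rewrite !ffunE eqxx eq_sym (negPf ij).
have [k0 k0f] : exists k0, k0 \notin codom f.
  apply/existsP; rewrite -negb_forall; apply: contraL ln => /forallP fsurj.
  rewrite -leqNgt -[n in (n <= _)%N]card_ord -[l in (_ <= l)%N]card_ord -(card_codom finj).
  by apply/subset_leq_card/fintype.subsetP => k _; have := fsurj k.
(* Comparing the minors of [Z *m T] and cancelling [a ^+ l] shows that [a] divides every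
   [\det Z * Xi g]; a Bezout relation between the [Xi g] concludes. *)
have prim (Z : 'M[int]_l) : (forall j k, (a %| (Z *m T) j k)%Z) -> (a %| \det Z)%Z.
  move=> aZT; pose Z0 := \matrix_(j, k) ((Z *m T) j k %/ a)%Z.
  have eZ : Z *m T = a%:M *m Z0.
    by apply/matrixP=> j k; rewrite mul_scalar_mx [RHS]mxE [X in a * X]mxE mulrC divzK.
  have [Xi' [hXi' [u hu]]] := pM.
  have eXi : Xi' =1 Xi by move=> g; apply: (@intr_inj R); rewrite -hXi -hXi'.
  have key g : \det Z * Xi g = a * minor Z0 g.
    apply: (@mulfI _ (a ^+ l)); first by rewrite expf_neq0.
    rewrite mulrCA -(minor_exchange_mx f g hXi) mulrA -minor_mulmx eZ minor_mulmx det_scalar.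
    by rewrite -mulrA [minor _ _ * _]mulrC.
  rewrite -[\det Z]mulr1 -hu mulr_sumr; apply: (big_ind (fun x => a %| x)%Z).
  - exact: dvdz0.
  - by move=> x y ax ay; apply: rpredD.
  by move=> g _; rewrite eXi mulrCA key mulrCA dvdz_mulr.
(* [K'] is the least integer with |a| <= K'^r, and K = K' - 1 is admissible for [small_residue]. If
   K' = 1, then K = 1 and a unit vector outside the columns [f] serves. *)
have [K [K' [K0 aK K2 [z [w [y0 yf yK]]]]]] : exists K K' : nat,
  [/\ (0 < K)%N, (`|a| <= K' ^ r)%N, (K' <= 2 * K)%N &
  exists (z : 'rV[int]_l) (w : 'rV[int]_n), let y := z *m T - a *: w in
    [/\ y != 0, forall i, y 0 (f i) = 0 & forall k, `|y 0 k| * K%:Z <= `|a|]].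
  have exK : exists K', (`|a| <= K' ^ r)%N.
    by exists `|a|%N; rewrite -{1}[`|a|%N]expn1 leq_pexp2l // absz_gt0.
  case: (ex_minnP exK) => -[|[|K]] aK Kmin.
  - by move: aK; rewrite exp0n // leqn0 absz_eq0 (negPf a0).
  - exists 1%N, 1%N; split=> //; exists 0, (delta_mx 0 k0); rewrite mul0mx sub0r.
    split=> [|i|k].
    + apply/eqP=> /matrixP/(_ 0 k0); rewrite !mxE !eqxx mulr1 => /eqP.
      by rewrite oppr_eq0 (negPf a0).
    + rewrite !mxE eqxx /= (_ : f i == k0 = false) ?mulr0 ?oppr0 //.
      by apply: contraNF k0f => /eqP<-; rewrite codom_f.
    rewrite mulr1 !mxE normrN normrM ler_piMr // eqxx /=.
    by case: (k == k0).
  exists K.+1, K.+2; split=> //; first by lia.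
  by apply: small_residue => //; rewrite ltnNge; apply/negP => /Kmin; rewrite ltnn.
set y := _ - _ in y0 yf yK.
have aR : a%:~R != 0 :> R by rewrite intr_eq0.
pose M1 : 'M[R]_(l.+1, n) := col_mx (map_mx intr w) M.
have ey k : y 0 k = (z *m T) 0 k - a * w 0 k.
  by rewrite /y [LHS]mxE [X in _ + X]mxE [X in - X]mxE.
(* Since [z *m T] lies in the row space of [M], the row [a *: w] can be replaced by the small row
   [- y]. *)
have mM1 g : a%:~R * minor M1 g =
    - \sum_j (y 0 (g j))%:~R * ((-1) ^+ j * minor M [ffun i => g (lift j i)]).
  have := minor_col_mx_mul (map_mx intr z *m \adj (colsub f M)) M g.
  rewrite -mulmxA -(exchange_mxE f hXi) -map_mxM !minor_col_mx => e.
  rewrite mulr_sumr -[RHS]add0r -[X in _ = X - _]e -sumrB; apply: eq_bigr => j _.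
  rewrite -mulrBl mulrA; congr (_ * _).
  by rewrite ey rmorphB rmorphM /= ![map_mx _ _ 0 _]mxE opprB addrCA subrr addr0.
have Mle : (M <= M1)%MS.
  have : (M <= col_mx (map_mx intr w) M)%MS by rewrite -addsmxE addsmxSr.
  by [].
pose Xi1 (g : {ffun 'I_l.+1 -> 'I_n}) : int :=
  \sum_j w 0 (g j) * ((-1) ^+ j * Xi [ffun i => g (lift j i)]).
have hXi1 : integral_minors M1 Xi1.
  move=> g; rewrite minor_col_mx rmorph_sum /=; apply: eq_bigr => j _.
  by rewrite !rmorphM rmorphXn rmorphN1 /= mxE hXi.
have bM1 g : `|minor M1 g| * K%:R <= l.+1%:R * `|a%:~R|.
  rewrite -(ler_pM2l (_ : 0 < `|a%:~R|)) ?normr_gt0 // mulrA -normrM mM1 normrN.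
  apply: (@le_trans _ _ (\sum_(j < l.+1) `|a%:~R : R| * `|a%:~R|)).
    apply: le_trans (ler_wpM2r (ler0n _ _) (ler_norm_sum _ _ _)) _.
    rewrite mulr_suml; apply: ler_sum => j _; rewrite !normrM mulrAC ler_pM ?mulr_ge0 //.
    + by rewrite -[K%:R]/(K%:Z%:~R) -!intr_norm -intrM ler_int; apply: yK.
    + by rewrite normrX normrN1 expr1n mul1r hXi -!intr_norm ler_int fmax.
  by rewrite sumr_const card_ord mulrCA mulr_natl.
(* Adjoin to [f] a column where [y] does not vanish: as [y] is 0 on the columns [f], only one term
   of [mM1] survives. *)
have [g1 g10] : exists g1, Xi1 g1 != 0.
  have [k yk] : exists k, y 0 k != 0.
    apply/existsP; apply: contraNT y0; rewrite negb_exists => /forallP e.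
    by apply/eqP/rowP=> k; have := e k; rewrite negbK => /eqP->; rewrite mxE.
  exists [ffun j => if unlift ord0 j is Some i then f i else k].
  rewrite -(intr_eq0 R) -hXi1; apply: contraNneq yk => m0.
  have := mM1 [ffun j => if unlift ord0 j is Some i then f i else k].
  rewrite m0 mulr0 (bigD1 ord0) //= big1 ?addr0 => [/esym/eqP|j].
    rewrite oppr_eq0 !mulf_eq0 intr_eq0 ffunE unlift_none => /orP[//|].
    rewrite (_ : [ffun _ => _] = f :> {ffun 'I_l -> 'I_n}) ?hXi ?intr_eq0 ?(negPf a0)
      ?expr0 ?oner_eq0 //.
    by apply/ffunP=> i; rewrite !ffunE liftK.
  by case: (unliftP ord0 j) => [i ->|->] // _; rewrite ffunE liftK yf mul0r.
have [M' [eM' pM' mM']] := primitive_of_integral (ltn0Sn l) hXi1 g10.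
exists M', (l.+1%:R * `|a%:~R| / K%:R); split=> // [|g|].
- by rewrite eM'.
- by apply: le_trans (mM' g) _; rewrite ler_pdivlMr ?ltr0n.
set A : R := `|a%:~R|; have A0 : 0 < A by rewrite normr_gt0.
have Amu : A <= mu by rewrite /A -hXi.
have K'0 : (0 < K')%N.
  by case: (K') aK => //; rewrite exp0n // leqn0 absz_eq0 (negPf a0).
(* From |a| <= K'^r and K' <= 2K, dividing by K^r costs 2^r and gains one power of |a|. *)
apply: (@le_trans _ _ ((2 * l.+1%:R) ^+ r * A ^+ r.-1)); last first.
  by rewrite ler_wpM2l ?exprn_ge0 ?mulr_ge0 ?ler0n // lerXn2r ?nnegrE ?(le_trans (ltW A0)
    Amu) ?(ltW A0).
rewrite -(ler_pM2r A0) -[X in _ <= X]mulrA -exprSr prednK // -exprMn.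
apply: (@le_trans _ _ ((l.+1%:R * A / K%:R) ^+ r * K'%:R ^+ r)).
  rewrite ler_wpM2l ?exprn_ge0 ?divr_ge0 ?mulr_ge0 ?ler0n ?(ltW A0) //.
  by rewrite /A -intr_norm -abszE -natrX ler_nat.
rewrite -exprMn lerXn2r ?nnegrE ?mulr_ge0 ?invr_ge0 ?ler0n ?(ltW A0) //.
rewrite -[l.+1%:R * A / _ * _]mulrA [2 * _]mulrC -[X in _ <= X]mulrA [2 * A]mulrC -!mulrA.
rewrite !ler_wpM2l ?ler0n ?(ltW A0) // mulrC ler_pdivrMr ?ltr0n //.
by rewrite -natrM ler_nat.
Qed.

Lemma primitive_bound_ge1 (R : numDomainType) (l n : nat) (M : 'M[R]_(l, n)) (mu : R) :
  primitive M -> (forall f, `|minor M f| <= mu) -> 1 <= mu.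
Proof.
move=> /primitive_neq0[Xi [f [hXi f0 _]]] /(_ f); apply: le_trans.
by rewrite hXi -intr_norm (ler_int _ 1) -gtz0_ge1 normr_gt0.
Qed.

(** Passing from dimension k to k+1 raises the bound to the power (n-k-1)/(n-k); these exponents
    telescope to (n-e)/(n-l). *)
Lemma extend_primitive_iter (R : realFieldType) (l n e : nat) : (l <= e <= n)%N ->
  exists2 C : R, 0 < C & forall (M : 'M[R]_(l, n)) (mu : R),
    primitive M -> (forall f, `|minor M f| <= mu) ->
    exists (M' : 'M[R]_(e, n)) (mu' : R),
      [/\ (M <= M')%MS, primitive M', forall f, `|minor M' f| <= mu' &
          mu' ^+ (n - l) <= C * mu ^+ (n - e)].
Proof.
elim: e => [|e IH] /andP[le en].
  case: l le => // _; exists 1 => // M mu pM hmu.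
  by exists M, mu; split=> //; rewrite mul1r.
move: le; rewrite leq_eqVlt => /predU1P[el|le].
  by move: en; rewrite -el => ln; exists 1 => // M mu pM hmu; exists M, mu; split=> //;
    rewrite mul1r.
have [|C1 C10 H1] := IH; first by rewrite -ltnS le ltnW.
have [C2 C20 H2] := extend_primitive R en.
have C0 : 0 < C2 ^+ (n - l) * C1 ^+ (n - e).-1 by rewrite mulr_gt0 ?exprn_gt0.
(* The natural constant is the (n-e)-th root of [C3]; [1 + C3] dominates it without extracting a
   root. *)
set C3 := _ * _ in C0; exists (1 + C3); first by rewrite addr_gt0.
move=> M mu pM hmu.
have [M1 [mu1 [MM1 pM1 hmu1 e1]]] := H1 M mu pM hmu.
have [M2 [mu2 [MM2 pM2 hmu2 e2]]] := H2 M1 mu1 pM1 hmu1.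
exists M2, mu2; split=> //; first exact: submx_trans MM2.
have ge0 k (N : 'M[R]_(k, n)) nu : primitive N -> (forall f, `|minor N f| <= nu) -> 0 <= nu.
  by move=> pN /(primitive_bound_ge1 pN); apply: le_trans.
have m0 := ge0 _ _ _ pM hmu; have m10 := ge0 _ _ _ pM1 hmu1; have m20 := ge0 _ _ _ pM2 hmu2.
have r0 : (0 < n - e)%N by rewrite subn_gt0.
rewrite -(ler_pXn2r r0) ?nnegrE ?mulr_ge0 ?exprn_ge0 ?addr_ge0 ?(ltW C0) //.
rewrite -exprM mulnC exprM.
apply: le_trans (_ : (C2 * mu1 ^+ (n - e).-1) ^+ (n - l) <= _).
  by rewrite lerXn2r ?nnegrE ?mulr_ge0 ?exprn_ge0 ?(ltW C20).
rewrite exprMn -exprM mulnC exprM.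
apply: le_trans (_ : C2 ^+ (n - l) * (C1 * mu ^+ (n - e)) ^+ (n - e).-1 <= _).
  rewrite ler_wpM2l ?exprn_ge0 ?(ltW C20) // lerXn2r ?nnegrE ?mulr_ge0 ?exprn_ge0 ?(ltW
    C10) //.
rewrite !exprMn mulrA -/C3 -!exprM -subnS mulnC ler_wpM2r ?exprn_ge0 //.
apply: (@le_trans _ _ (1 + C3)); first by rewrite lerDr.
by rewrite ler_eXnr ?lerDl ?(ltW C0).
Qed.

(** * Proximity *)

(* For a unit W near V in the kernel of D, W D is small, hence so is det (M D)
   for every M whose row space contains W. *)
Lemma det_le_wedge (R : realFieldType) (d n : nat) (D : 'M[R]_(n, d.+1)) :
  exists2 C : R, 0 < C & forall (M : 'M[R]_(d.+1, n)) (f : {ffun 'I_d.+1 -> 'I_n})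
      (V W : 'rV[R]_n) (om : R),
    minor M f != 0 -> (forall g, `|minor M g| <= `|minor M f|) ->
    V *m D = 0 -> (W <= M)%MS ->
    (forall i k, `|V 0 i * W 0 k - V 0 k * W 0 i| <= om) ->
    forall k k', `|\det (M *m D)| * (`|V 0 k| * `|W 0 k'|) <= C * `|minor M f| * om.
Proof.
pose B : R := 1 + \sum_i \sum_j `|D i j|.
have B0 : 0 < B by rewrite ltr_wpDr // sumr_ge0 // => i _; rewrite sumr_ge0.
have DB m (X : 'M[R]_(m, n)) x : 0 <= x -> (forall i k, `|X i k| <= x) ->
    forall i j, `|(X *m D) i j| <= x * B.
  move=> x0 Xx i j; rewrite mxE; apply: le_trans (ler_norm_sum _ _ _) _.
  apply: (@le_trans _ _ (\sum_k x * \sum_j `|D k j|)).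
    apply: ler_sum => k _; rewrite normrM ler_pM // (bigD1 j) //= lerDl sumr_ge0 //.
  rewrite -mulr_sumr /B mulrDr mulr1.
  by rewrite lerDr.
pose C := d.+1%:R * (d.+1%:R * (B * (d`!%:R * B ^+ d))) : R.
have C0 : 0 < C by rewrite !mulr_gt0 ?exprn_gt0 ?ltr0n ?fact_gt0.
exists C => // M f V W om; set a := minor M f => a0 amax VD /submxP[b eW] hom k0 k1.
have [k Vk] : exists k, forall k', `|V 0 k'| <= `|V 0 k|.
  by have [k _ kmax] := @Order.TotalTheory.arg_maxP _ _ _ k0 xpredT (fun k => `|V 0 k|)
    isT; exists k => k'; apply: kmax.
have om0 : 0 <= om by apply: le_trans (hom k k).
have [Vk0|Vk0] := eqVneq (V 0 k) 0.
  have -> : V 0 k0 = 0 by apply/eqP; rewrite -normr_le0; have := Vk k0; rewrite Vk0 normr0.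
  by rewrite normr0 mul0r mulr0; apply: mulr_ge0 => //; apply: mulr_ge0 => //; apply: ltW.
set A := `|a|; have A0 : 0 < A by rewrite normr_gt0.
set v := `|V 0 k|; have v0 : 0 < v by rewrite normr_gt0.
(* [y] has the same image under [D] as [W], and its entries are coordinates of the wedge of [V] and
   [W] divided by the largest coordinate of [V]. *)
pose y := W - (W 0 k / V 0 k) *: V; pose T := exchange_mx (minor M) f; pose S := T *m D.
have yb i j : `|y i j| <= om / v.
  rewrite ord1 ler_pdivlMr // -normrM.
  suff -> : y 0 j * V 0 k = V 0 k * W 0 j - V 0 j * W 0 k by apply: hom.
  by rewrite !mxE; field.
have Tb i j : `|T i j| <= A by rewrite mxE; apply: amax.
(* Coordinates of [a *: W] on the rows of [T]. Their product with [S] is [a] times the small vector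
   [y *m D], and [\adj S] then isolates [b'] times [\det S]. *)
pose b' := b *m colsub f M.
have eT : T = \adj (colsub f M) *m M by rewrite adj_colsub.
have aW : a *: W = b' *m T.
  by rewrite eT mulmxA -[b' *m _]mulmxA mul_mx_adj mul_mx_scalar -scalemxAl eW.
have bS : b' *m S = a *: (y *m D).
  by rewrite mulmxA -aW -scalemxAl mulmxBl -scalemxAl VD scaler0 subr0.
have dS : \det S = a ^+ d * \det (M *m D).
  apply: (@mulfI _ a) => //; rewrite mulrA -exprS -det_scalar -mul_mx_adj.
  by rewrite det_mulmx -mulrA -[X in _ = _ * X]det_mulmx mulmxA -eT.
have b'S j : b' 0 j * \det S = a * (y *m D *m \adj S) 0 j.
  by have := congr1 (fun X => (X *m \adj S) 0 j) bS;
    rewrite /= -(mulmxA b' S) mul_mx_adj mul_mx_scalar -scalemxAl [LHS]mxE [RHS]mxE mulrC.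
have yv0 : 0 <= om / v by rewrite divr_ge0 // ltW.
have Sadj := ler_norm_adj (DB _ T A (ltW A0) Tb).
have b'b j : `|b' 0 j| * `|\det (M *m D)| <= d.+1%:R * (B * (d`!%:R * B ^+ d)) * A * (om / v).
  rewrite -(ler_pM2l (exprn_gt0 d A0)) mulrCA /A -normrX -normrM -dS -normrM b'S.
  rewrite normrM -/A mxE.
  apply: le_trans (ler_wpM2l (ltW A0) (ler_norm_sum _ _ _)) _.
  apply: (@le_trans _ _ (A * \sum_(i < d.+1) om / v * B * (d`!%:R * (A * B) ^+ d))).
    rewrite ler_wpM2l ?(ltW A0) //; apply: ler_sum => i _.
    by rewrite normrM ler_pM // DB.
  by rewrite sumr_const card_ord -mulr_natl exprMn le_eqVlt normrX -/A; apply/orP; left;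
    apply/eqP; ring.
have Wb : `|W 0 k1| <= \sum_j `|b' 0 j|.
  have aWk : a * W 0 k1 = (b' *m T) 0 k1 by rewrite -aW mxE.
  rewrite -(ler_pM2l A0) -normrM aWk mxE.
  apply: le_trans (ler_norm_sum _ _ _) _; rewrite mulr_sumr; apply: ler_sum => j _.
  by rewrite normrM mulrC ler_wpM2r.
apply: (@le_trans _ _ (`|\det (M *m D)| * (v * \sum_j `|b' 0 j|))).
  by rewrite ler_wpM2l // ler_pM.
rewrite mulrCA mulr_sumr -ler_pdivlMl //.
apply: (@le_trans _ _ (\sum_(j < d.+1) d.+1%:R * (B * (d`!%:R * B ^+ d)) * A * (om / v))).
  by apply: ler_sum => j _; rewrite mulrC.
rewrite sumr_const card_ord -[_ *+ d.+1]mulr_natl /C le_eqVlt; apply/orP; left; apply/eqP;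
  ring.
Qed.

Lemma dotp_ge0 (R : realType) (n : nat) (V : 'rV[R]_n) : 0 <= dotp V V.
Proof. by rewrite sumr_ge0 // => i _; rewrite -expr2 sqr_ge0. Qed.

Lemma enorm_gt0 (R : realType) (n : nat) (V : 'rV[R]_n) : V != 0 -> 0 < enorm V.
Proof.
move=> V0; rewrite sqrtr_gt0 lt_neqAle dotp_ge0 andbT eq_sym.
apply: contraNneq V0 => /eqP; rewrite psumr_eq0 => [/allP e|i _];
  last by rewrite -expr2 sqr_ge0.
apply/eqP/rowP=> i; rewrite mxE; have := e i; rewrite mem_index_enum => /(_ isT).
by rewrite -expr2 sqrf_eq0 => /eqP.
Qed.

Lemma enorm_le_sum (R : realType) (n : nat) (V : 'rV[R]_n) : enorm V <= \sum_i `|V 0 i|.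
Proof.
have s0 : 0 <= \sum_i `|V 0 i| by rewrite sumr_ge0.
rewrite -[X in _ <= X](ger0_norm s0) -sqrtr_sqr ler_wsqrtr // /dotp expr2 mulr_suml.
apply: ler_sum => i _; rewrite -expr2 -real_normK ?num_real // expr2 ler_wpM2l //.
by rewrite (bigD1 i) //= lerDl sumr_ge0.
Qed.

Lemma le_wedge_norm (R : realType) (n : nat) (V W : 'rV[R]_n) i k :
  `|V 0 i * W 0 k - V 0 k * W 0 i| <= wedge_norm V W.
Proof.
wlog ik : i k / (i < k)%N => [H|].
  have [ik|ki|/val_inj->] := ltngtP i k; first exact: H.
    by rewrite distrC; apply: H.
  by rewrite subrr normr0 sqrtr_ge0.
rewrite -sqrtr_sqr ler_wsqrtr // (bigD1 i) //= (bigD1 k) //= -addrA lerDl.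
rewrite addr_ge0 ?sumr_ge0 // => *; rewrite ?sqr_ge0 // sumr_ge0 // => *; exact: sqr_ge0.
Qed.

Lemma root_exists (R : realType) (n : nat) (x : R) : 0 <= x -> exists t : R, t ^+ n.+1 = x.
Proof.
move=> x0; exists (x `^ n.+1%:R^-1).
by rewrite -powR_mulrn ?powR_ge0 // -powRrM mulVf ?pnatr_eq0 // powRr1.
Qed.

Lemma primitive_mem_prime (R : numDomainType) (l n p : nat) (M : 'M[R]_(l, n)) Xi :
  prime p -> integral_minors M Xi -> primitive M -> exists f, ~~ (p%:Z %| Xi f)%Z.
Proof.
move=> pp hXi [Xi' [hXi' [u hu]]]; apply/existsP; apply: contraTT pp.
rewrite negb_exists => /forallP e; apply/negP => pp.
suff : (p%:Z %| 1%R)%Z by rewrite dvdzE /= Euclid_dvd1.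
rewrite -hu; apply: (big_ind (fun x => p%:Z %| x)%Z) => [|x y|f _]; first exact: dvdz0.
  exact: rpredD.
have -> : Xi' f = Xi f by apply: (@intr_inj R); rewrite -hXi -hXi'.
by rewrite dvdz_mull //; have := e f; rewrite negbK.
Qed.

(** The zero subspace, from which going up produces a primitive matrix of any size d x n with d <=
    n. *)
Lemma primitive_empty (R : numDomainType) (n : nat) (M : 'M[R]_(0, n)) : primitive M.
Proof.
exists (fun=> 1); split=> [f|]; first by rewrite /minor det_mx00.
exists (fun=> 1); under eq_bigr => f _ do rewrite mulr1.
by rewrite sumr_const card_ffun !card_ord expn0.
Qed.

(** In dimension d, [det_le_wedge] and [det_euler_eval_ge] give psi >> mu'^(-n). Smaller [l] is
    reduced to this by going up; the power n - l keeps all exponents integral. *)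
Lemma psi_lower_bound (R : realType) (n d : nat) : (0 < d <= n)%N ->
  exists2 D : 'M[R]_(n, d), \rank D = d &
  forall l, (l <= d)%N -> exists2 c : R, 0 < c &
    forall (M : 'M[R]_(l, n)) mu V W, primitive M -> (forall f, `|minor M f| <= mu) ->
    V *m D = 0 -> (W <= M)%MS -> V != 0 -> W != 0 ->
    c <= psi V W ^+ (n - l) * mu ^+ (n * (n - d)).
Proof.
case: d n => // d [//|n] /andP[_ dn].
have [p np pp] := prime_above n.
have [t tn] := root_exists n (ler0n R p).
pose D : 'M[R]_(n.+1, d.+1) := euler_eval n.+1 d.+1 t.
have [c c0 hc] := det_euler_eval_ge d.+1 pp np tn.
have [C C0 hC] := det_le_wedge D.
exists D.
  (* Rank of [D]: going up from the zero subspace gives a primitive [M] with [\det (M *m D)]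
     nonzero. *)
  have [|C1 C10 /(_ 0 1 (primitive_empty _))] := @extend_primitive_iter R 0 n.+1 d.+1;
    first by rewrite dn.
  case=> [f|M [mu [_ pM hmu _]]]; first by rewrite /minor det_mx00 normr1.
  have [Xi [_ [hXi _ _]]] := primitive_neq0 pM.
  have [f pf] := primitive_mem_prime pp hXi pM.
  have := hc M Xi f mu hXi pf hmu.
  apply: contraTeq => rD; rewrite -ltNge (_ : \det _ = 0) ?normr0 ?mul0r //.
  apply/eqP; rewrite -[_ == 0]negbK -unitfE -unitmxE; apply: contraNN rD => /mxrank_unit rMD.
  by rewrite eqn_leq rank_leq_col -{1}rMD mxrankM_maxr.
move=> l ld.
have [|C1 C10 hext] := @extend_primitive_iter R l n.+1 d.+1; first by rewrite ld dn.
(* The number of pairs of coordinates over which [hC] is summed to pass to Euclidean norms. *)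
pose N := n.+1%:R ^+ 2 : R.
exists ((c / (C * N)) ^+ (n.+1 - l) / C1 ^+ n.+1).
  by rewrite divr_gt0 ?exprn_gt0 ?divr_gt0 ?mulr_gt0 ?exprn_gt0 ?ltr0n.
move=> M mu V W pM hmu VD WM V0 W0.
have [M' [mu' [MM' pM' hmu' emu]]] := hext M mu pM hmu.
have [Xi [f [hXi f0 fmax]]] := primitive_neq0 pM'.
have [f' pf'] := primitive_mem_prime pp hXi pM'.
have {}hc := hc M' Xi f' mu' hXi pf' hmu'.
have mu'0 : 0 < mu' by apply: lt_le_trans (primitive_bound_ge1 pM' hmu').
have a0 : minor M' f != 0 by rewrite hXi intr_eq0.
have amax g : `|minor M' g| <= `|minor M' f| by rewrite !hXi -!intr_norm ler_int.
have {}hC := hC M' f V W _ a0 amax VD (submx_trans WM MM') (le_wedge_norm V W).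
set dt := `|\det _| in hc hC.
have n0 : 0 < enorm V * enorm W by rewrite mulr_gt0 ?enorm_gt0.
have h1 : dt <= C * mu' * N * psi V W.
  rewrite /psi mulrA ler_pdivlMr //.
  apply: (@le_trans _ _ (dt * ((\sum_i `|V 0 i|) * (\sum_i `|W 0 i|)))).
    by rewrite ler_wpM2l ?normr_ge0 // ler_pM ?enorm_le_sum ?ltW ?enorm_gt0.
  rewrite mulr_suml mulr_sumr.
  apply: (@le_trans _ _ (\sum_(i < n.+1) \sum_(j < n.+1) C * mu' * wedge_norm V W)).
    apply: ler_sum => i _; rewrite !mulr_sumr; apply: ler_sum => j _.
    apply: le_trans (hC i j) _; rewrite ler_wpM2r ?sqrtr_ge0 // ler_wpM2l // ltW //.
  rewrite !sumr_const !card_ord -!mulrnA -[_ *+ (_ * _)]mulr_natl /N -natrX.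
  by rewrite le_eqVlt; apply/orP; left; apply/eqP; ring.
have psi0 : 0 <= psi V W by rewrite divr_ge0 ?sqrtr_ge0 // ltW.
have h2 : c / (C * N) <= psi V W * mu' ^+ n.+1.
  rewrite ler_pdivrMr ?mulr_gt0 ?exprn_gt0 ?ltr0n //; apply: le_trans hc _.
  apply: le_trans (ler_wpM2r _ h1) _; first by rewrite exprn_ge0 // ltW.
  by rewrite le_eqVlt exprS; apply/orP; left; apply/eqP; ring.
rewrite ler_pdivrMr ?exprn_gt0 //.
apply: le_trans (_ : (psi V W * mu' ^+ n.+1) ^+ (n.+1 - l) <= _).
  have q0 : 0 <= c / (C * N) by rewrite divr_ge0 ?mulr_ge0 ?exprn_ge0 ?ler0n ?ltW.
  by rewrite lerXn2r ?nnegrE // mulr_ge0 ?exprn_ge0 // ltW.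
have e : mu' ^+ n.+1 ^+ (n.+1 - l) = mu' ^+ (n.+1 - l) ^+ n.+1 by rewrite -!exprM mulnC.
rewrite exprMn e -[X in _ <= X]mulrA ler_wpM2l ?exprn_ge0 //.
rewrite [(n.+1 * _)%N]mulnC exprM -exprMn [X in _ <= X ^+ _]mulrC.
have mu0 : 0 <= mu by apply: le_trans (primitive_bound_ge1 pM hmu).
by rewrite lerXn2r ?nnegrE ?mulr_ge0 ?exprn_ge0 // ltW.
Qed.

Local Open Scope classical_set_scope.
Local Open Scope ring_scope.

(** * Attainment of the first proximity, by compactness of unit spheres *)

Lemma continuous_bigsum (R : realType) (T : topologicalType) (I : Type) (r : seq I) (P :
  pred I)
    (F : I -> T -> R) :
  (forall i, continuous (F i)) -> continuous (fun t => \sum_(i <- r | P i) F i t).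
Proof.
move=> cF; elim: r => [|i r IH].
  rewrite (_ : (fun _ => _) = cst 0); first exact: cst_continuous.
  by apply/funext=> t; rewrite big_nil.
case Pi: (P i).
  rewrite (_ : (fun _ => _) = F i \+ fun t => \sum_(i <- r | P i) F i t).
    by move=> t; apply: cvgD; [exact: cF | exact: IH].
  by apply/funext=> t; rewrite big_cons Pi.
by rewrite (_ : (fun _ => _) = fun t => \sum_(i <- r | P i) F i t) //; apply/funext=> t;
  rewrite big_cons Pi.
Qed.

Lemma memv_span_rows (F : fieldType) (n l : nat) (M : 'M[F]_(l, n)) (v : 'rV[F]_n) :
  (v \in <<[seq row i M | i <- enum 'I_l]>>%VS) = (v <= M)%MS.
Proof.
apply/idP/idP=> [|/submxP[b ->]].
  move=> /(@coord_span _ _ _ (in_tuple _)) ->; apply: summx_sub => i _; apply: scalemx_sub.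
  have /mapP[j _ ->] := mem_nth 0 (ltn_ord i); exact: row_sub.
rewrite mulmx_sum_row; apply: memv_suml => i _; apply/memvZ/memv_span.
by apply: map_f; rewrite mem_enum.
Qed.

Lemma row_basis_exists (F : fieldType) (n : nat) (C : {vspace 'rV[F]_n}) :
  exists N : 'M[F]_(\dim C, n), forall v, (v \in C) = (v <= N)%MS.
Proof.
exists (\matrix_i (vbasis C)`_i) => v; rewrite -memv_span_rows -{1}(span_basis (vbasisP C)).
congr (_ \in <<_>>%VS); apply: (@eq_from_nth _ 0) => [|i]; rewrite size_tuple.
  by rewrite size_map size_enum_ord.
move=> iC; rewrite (nth_map (Ordinal iC)) ?size_enum_ord // rowK.
by rewrite (@nth_ord_enum _ _ (Ordinal iC)).
Qed.

Lemma dotp1_coord (R : realType) (n : nat) (x : 'rV[R]_n) i : dotp x x = 1 -> `|x 0 i| <= 1.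
Proof.
move=> x1; rewrite -(ler_pXn2r (_ : 0 < 2)%N) ?nnegrE // expr1n real_normK ?num_real // -x1.
by rewrite /dotp (bigD1 i) //= -expr2 lerDl sumr_ge0 // => j _; rewrite -expr2 sqr_ge0.
Qed.

Lemma enorm_sqr (R : realType) (n : nat) (V : 'rV[R]_n) : enorm V ^+ 2 = dotp V V.
Proof. by rewrite sqr_sqrtr // dotp_ge0. Qed.

Lemma enormZ (R : realType) (n : nat) (a : R) (V : 'rV[R]_n) : enorm (a *: V) = `|a| * enorm V.
Proof.
rewrite /enorm -sqrtr_sqr -sqrtrM ?sqr_ge0 //; congr Num.sqrt.
by rewrite /dotp mulr_sumr; apply: eq_bigr => i _; rewrite !mxE; ring.
Qed.

Lemma psiZ (R : realType) (n : nat) (a b : R) (V W : 'rV[R]_n) :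
  a != 0 -> b != 0 -> psi (a *: V) (b *: W) = psi V W.
Proof.
move=> a0 b0; rewrite /psi !enormZ.
have -> : wedge_norm (a *: V) (b *: W) = `|a * b| * wedge_norm V W.
  rewrite /wedge_norm -sqrtr_sqr -sqrtrM ?sqr_ge0 //; congr Num.sqrt.
  rewrite mulr_sumr; apply: eq_bigr => i _; rewrite mulr_sumr; apply: eq_bigr => k _.
  by rewrite !mxE; ring.
by rewrite mulrACA -normrM -mulf_div divff ?mul1r // normr_eq0 mulf_neq0.
Qed.

(** [psi] is invariant under scaling, so a minimum over unit vectors is a minimum over all nonzero
    pairs. The set defining [psi_ 1] is then inhabited, and [xget] does not return its default. *)
Lemma psi_1_attained (R : realType) (n : nat) (A B : {vspace 'rV[R]_n}) :
  (0 < \dim A)%N -> (0 < \dim B)%N ->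
  exists X Y, [/\ X \in A, Y \in B, X != 0, Y != 0 & psi_ 1 A B = psi X Y].
Proof.
move=> dA dB.
have unit_sphere (C : {vspace 'rV[R]_n}) : (0 < \dim C)%N ->
    compact [set x | x \in C /\ dotp x x = 1] /\ [set x | x \in C /\ dotp x x = 1] !=set0.
  move=> dC; split.
    have cube : compact [set v : 'rV[R]_n | forall i, `[-1 : R, 1]%classic (v ord0 i)].
      by apply: (@rV_compact R n (fun=> `[-1 : R, 1]%classic)) => i; apply: segment_compact.
    apply: (subclosed_compact _ cube) => [|x [_ x1] i /=]; last first.
      by rewrite in_itv /= -ler_norml dotp1_coord.
    have [N CN'] := row_basis_exists C.
    have CN y : (y \in C) = (y *m cokermx N == 0) by rewrite CN' submxE.
    have cc i : continuous (fun x : 'rV[R]_n => x 0 i).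
      exact: (@coord_continuous R 1 n 0 i).
    pose h j (x : 'rV[R]_n) := \sum_i x 0 i * cokermx N i j.
    have ch j : continuous (h j).
      apply: continuous_bigsum => i x; exact: (cvgM (cc i x) (cvg_cst _)).
    have cd : continuous (fun x : 'rV[R]_n => dotp x x).
      apply: continuous_bigsum => i x; exact: (cvgM (cc i x) (cc i x)).
    have -> : [set x | x \in C /\ dotp x x = 1] =
        (\bigcap_(j in setT) (h j @^-1` [set 0])) `&` ((fun x => dotp x x) @^-1` [set 1]).
      apply/seteqP; split=> x /= [].
        rewrite CN => /eqP xN x1; split=> // j _ /=.
        by have /rowP/(_ j) := xN; rewrite !mxE.
      move=> xh x1; split=> //; rewrite CN; apply/eqP/rowP=> j; rewrite !mxE.
      exact: (xh j).
    have c1 y : closed [set y : R] by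
      apply/accessible_closed_set1/hausdorff_accessible/Rhausdorff.
    apply: closedI; last exact: ((continuous_closedP _).1 cd).
    by apply: closed_bigI => j _; apply: ((continuous_closedP _).1 (ch j)).
  exists ((enorm (vpick C))^-1 *: vpick C).
  have v0 : vpick C != 0 by rewrite vpick0 -dimv_eq0 -lt0n.
  split; first by rewrite memvZ ?memv_pick.
  by rewrite -enorm_sqr enormZ normfV gtr0_norm ?enorm_gt0 // mulVf ?expr1n // gt_eqF
    ?enorm_gt0.
have [cA [X0 [X0A X01]]] := unit_sphere A dA; have [cB [Y0 [Y0B Y01]]] := unit_sphere B dB.
have cK := compact_setX cA cB.
(* The squared wedge norm; on unit vectors [psi] is its square root. *)
pose g (z : 'rV[R]_n * 'rV[R]_n) : R := \sum_(i < n) \sum_(k < n | (i < k)%N)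
    (z.1 0 i * z.2 0 k - z.1 0 k * z.2 0 i) ^+ 2.
have cg : continuous g.
  have c1 i : continuous (fun z : 'rV[R]_n * 'rV[R]_n => z.1 0 i).
    by move=> z; apply: (@continuous_comp _ _ _ fst (fun x : 'rV[R]_n => x 0 i) z);
      [exact: cvg_fst | exact: (@coord_continuous R 1 n 0 i)].
  have c2 i : continuous (fun z : 'rV[R]_n * 'rV[R]_n => z.2 0 i).
    by move=> z; apply: (@continuous_comp _ _ _ snd (fun x : 'rV[R]_n => x 0 i) z);
      [exact: cvg_snd | exact: (@coord_continuous R 1 n 0 i)].
  apply: continuous_bigsum => i; apply: continuous_bigsum => k z.
  by apply: (cvgM (cvgB (cvgM (c1 _ z) (c2 _ z)) (cvgM (c1 _ z) (c2 _ z))) (cvgB (cvgM (c1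
    _ z) (c2 _ z)) (cvgM (c1 _ z) (c2 _ z)))).
have [|[X Y] /set_mem [[/= XA X1] [/= YB Y1]] gmin] := compact_EVT_min _ cK
  (continuous_subspaceT cg).
  by exists (X0, Y0).
have unit1 (V : 'rV[R]_n) : dotp V V = 1 -> enorm V = 1 by rewrite /enorm => ->;
  rewrite sqrtr1.
have spanfirst0 (C : {vspace 'rV[R]_n}) Z : orth_compl C (span_first Z 0) = [set v | v \in C].
  apply/seteqP; split=> v /=; first by case.
  move=> vC; split=> // w; rewrite /span_first /= span_nil memv0 => /eqP->.
  by rewrite /dotp big1 // => i _; rewrite mxE mulr0.
have : exists s, [set s | exists X Y, canonical_pairs A B 1 X Y /\ s = psi (X 1) (Y 1)] s.
  exists (psi X Y), (fun=> X), (fun=> Y); split=> // k; rewrite ltnS leqn0 => /eqP->.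
  rewrite !spanfirst0; split=> //=; try exact: unit1.
  move=> V W VA WB V0 W0.
  have nV := enorm_gt0 V0; have nW := enorm_gt0 W0.
  rewrite -(@psiZ _ _ (enorm V)^-1 (enorm W)^-1 V) ?invr_eq0 ?gt_eqF //.
  have n1 (U : 'rV[R]_n) : 0 < enorm U -> enorm ((enorm U)^-1 *: U) = 1.
    by move=> U0; rewrite enormZ normfV gtr0_norm // mulVf // gt_eqF.
  have d1 (U : 'rV[R]_n) : 0 < enorm U -> dotp ((enorm U)^-1 *: U) ((enorm U)^-1 *: U) = 1.
    by move=> U0; rewrite -enorm_sqr n1 // expr1n.
  rewrite /psi !n1 // (unit1 X) // (unit1 Y) // !mulr1 !divr1 ler_wsqrtr //.
  apply: (gmin (_, _)); apply/mem_set; split; split; rewrite ?memvZ ?d1 //.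
move=> /(@xgetPex _ 0) [X' [Y' [/(_ 0%N isT)[]]]].
rewrite !spanfirst0 /= => X'A Y'B X'1 Y'1 _ e.
have n0 (U : 'rV[R]_n) : enorm U = 1 -> U != 0.
  move=> U1; apply/eqP => U0; move: U1; rewrite -[U]scale1r U0 scaler0 -(scale0r 0) enormZ
    normr0 mul0r.
  by move/esym/eqP; rewrite oner_eq0.
by exists (X' 1%N), (Y' 1%N); split=> //; apply: n0.
Qed.

(** * Rational subspaces and heights *)

Lemma row_free_minor (F : fieldType) (l n : nat) (M : 'M[F]_(l, n)) :
  row_free M -> exists f, minor M f != 0.
Proof.
rewrite /row_free -mxrank_tr => fM.
have fullM : row_full M^T by rewrite /row_full.
exists (fullrankfun fullM); have := fullrowsub_unit fullM.
rewrite unitmxE unitfE -det_tr; congr (_ != 0); congr (\det _).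
by apply/matrixP=> i j; rewrite !mxE.
Qed.

(** The denominators of the maximal minors of a rational basis are cleared by scaling one row; then
    the minors are divided by their gcd. *)
Lemma rational_primitive (R : realType) (n : nat) (B : {vspace 'rV[R]_n}) :
  rational_subspace B -> (0 < \dim B)%N ->
  exists2 M : 'M[R]_(\dim B, n), primitive M & forall v, (v \in B) = (v <= M)%MS.
Proof.
move=> [s sB] dB; set l := \dim B in dB *.
have sl : size s = l by have := size_basis (X := in_tuple _) sB; rewrite size_map => <-.
pose Mq : 'M[rat]_(l, n) := \matrix_i s`_i; pose M0 : 'M[R]_(l, n) := map_mx ratr Mq.
have rowsM : [seq row i M0 | i <- enum 'I_l] = [seq map_mx ratr v | v <- s].
  apply: (@eq_from_nth _ 0) => [|i]; first by rewrite size_map size_enum_ord size_map sl.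
  rewrite size_map size_enum_ord => il.
  rewrite (nth_map (Ordinal il)) ?size_enum_ord // (nth_map 0) ?sl //.
  by rewrite (@nth_ord_enum _ _ (Ordinal il)) -map_row rowK.
have MB v : (v \in B) = (v <= M0)%MS.
  by rewrite -memv_span_rows rowsM (span_basis sB).
have [f0 f00] : exists f, minor M0 f != 0.
  apply: row_free_minor; rewrite -kermx_eq0; apply/eqP/row_matrixP => k.
  set b := row k _; have bM : b *m M0 = 0 by apply/sub_kermxP/row_sub.
  have := basis_free sB; rewrite -rowsM => /(@freeP _ _ _ (in_tuple _)) fr.
  have lsz : size [seq row i M0 | i <- enum 'I_l] = l by rewrite size_map size_enum_ord.
  pose cf (i : 'I_(size [seq row i M0 | i <- enum 'I_l])) := b 0 (cast_ord lsz i).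
  have cf0 : forall i, cf i = 0.
    apply: fr; rewrite -[RHS]bM mulmx_sum_row [RHS](reindex (cast_ord lsz)) /=; last first.
      by exists (cast_ord (esym lsz)) => i _; rewrite ?cast_ordK ?cast_ordKV.
    apply: eq_bigr => i _; congr (_ *: _).
    have il : (i < l)%N by rewrite -[X in (_ < X)%N]lsz.
    rewrite (nth_map (Ordinal il)) ?size_enum_ord // (@nth_ord_enum _ _ (Ordinal il)).
    by congr row; apply/val_inj.
  by rewrite row0; apply/rowP => i; rewrite [RHS]mxE -(cf0 (cast_ord (esym lsz) i)) /cf
    cast_ordKV.
pose q f := minor Mq f; have qM f : minor M0 f = ratr (q f).
  by rewrite /minor -map_mxsub det_map_mx.
pose Den : int := \prod_f denq (q f).
have Den0 : Den != 0 by apply/prodf_neq0 => f _; rewrite denq_neq0.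
have DenR : Den%:~R != 0 :> R by rewrite intr_eq0.
have [M1 [eM1 mM1]] := scale_minors M0 dB DenR.
pose Xi f : int := numq (q f) * \prod_(g | g != f) denq (q g).
have hXi : integral_minors M1 Xi.
  move=> f; rewrite mM1 qM /Xi /Den (bigD1 f) //= !rmorphM /= mulrAC; congr (_ * _).
  by rewrite /ratr mulrCA mulfV ?mulr1 // intr_eq0 denq_neq0.
have Xi0 : Xi f0 != 0.
  by rewrite -(intr_eq0 R) -hXi mM1 mulf_neq0.
have [M [eM pM _]] := primitive_of_integral dB hXi Xi0.
by exists M => // v; rewrite MB eM eM1.
Qed.

(** Relates the maps indexing [minor] to the increasing sequences of [plucker_index]. *)
Lemma sort_ffun (l n : nat) (f : {ffun 'I_l -> 'I_n}) : injective f ->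
  exists (g : {ffun 'I_l -> 'I_n}) (s : 'S_l),
    (forall i k : 'I_l, (i < k)%N -> (g i < g k)%N) /\ forall i, f i = g (s i).
Proof.
move=> finj; pose t := sort (relpre val leq) (codom f).
have st : size t = l by rewrite size_sort size_codom card_ord.
have ut : uniq t by rewrite sort_uniq; apply/injectiveP.
have ft i : f i \in t by rewrite mem_sort codom_f.
have it i : (index (f i) t < l)%N by rewrite -[X in (_ < X)%N]st index_mem.
have so : sorted (relpre val leq) t by apply: sort_sorted => x y; apply: leq_total.
case: l f finj t st ut ft it so => [|l] f finj t st ut ft it so.
  by exists f, 1%g; split=> -[].
have x0 := f ord0.
have pinj : injective (fun i => Ordinal (it i)).
  move=> i j /(congr1 val) /= e; apply: finj.
  by rewrite -(nth_index x0 (ft i)) e nth_index.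
exists [ffun i : 'I_l.+1 => nth x0 t i], (perm pinj); split=> [i k ik|i]; last first.
  by rewrite ffunE permE /= nth_index.
rewrite !ffunE ltn_neqAle; apply/andP; split.
  by rewrite -[_ == _ :> nat]/(nth x0 t i == nth x0 t k) nth_uniq ?st // neq_ltn ik.
have tr : transitive (relpre val leq : rel 'I_n) by move=> ? ? ?; apply: leq_trans.
have := sorted_leq_nth tr (fun x => leqnn _) x0 so.
by move=> /(_ i k); rewrite !inE st; apply => //; apply: ltnW.
Qed.

Lemma minor_perm (R : comPzRingType) (l n : nat) (M : 'M[R]_(l, n)) (f g : {ffun 'I_l ->
  'I_n}) (s : 'S_l) :
  (forall i, f i = g (s i)) -> minor M f = (-1) ^+ s * minor M g.
Proof.
move=> fg; rewrite /minor (_ : colsub f M = col_perm s (colsub g M)).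
  by rewrite col_permE det_mulmx det_perm odd_permV mulrC.
by apply/matrixP=> i j; rewrite !mxE fg.
Qed.

(** The first alternative is the default value of [xget]. Otherwise every minor is 0 or, up to sign,
    a coordinate of the coprime Plücker vector, so it is bounded by the norm. *)
Lemma height_primitive (R : realType) (n : nat) (B : {vspace 'rV[R]_n}) :
  height B = 0 \/
  exists M : 'M[R]_(\dim B, n), [/\ primitive M, forall v, (v \in B) = (v <= M)%MS &
    forall f, `|minor M f| <= height B].
Proof.
rewrite /height; set S := [set h | _].
have [[h Sh]|nS] := pselect (exists h, S h); last first.
  by left; apply: xgetPN => h Sh; apply: nS; exists h.
right; move: (xgetPex 0 (ex_intro _ h Sh)); set H := xget 0 S => -[Xi [[M [MB XiM]] gXi eH]].
pose incr (f : {ffun 'I_(\dim B) -> 'I_n}) :=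
  [forall i : 'I_(\dim B), forall k : 'I_(\dim B), (i < k)%N ==> (f i < f k)%N].
have minor_incr f : minor M f = 0 \/
    exists (g : @plucker_index n (\dim B)) (b : bool), minor M f = (-1) ^+ b * (Xi g)%:~R.
  have [/injectiveP/sort_ffun[g [s [gi fg]]]|/injectivePn[i [k ik fik]]] := boolP
    (injectiveb f).
    have Pg : incr g by apply/forallP=> i; apply/forallP=> k; apply/implyP; apply: gi.
    right; exists (exist _ g Pg), (odd_perm s); rewrite (minor_perm M fg) XiM.
    by [].
  by left; apply: (@minor_eq0 _ _ _ M f i k ik fik).
have [Xi' hXi'] : exists Xi', integral_minors M Xi'.
  have := fin_all_exists (fun f => _ : exists z : int, minor M f = z%:~R); apply => f.
  have [->|[g [b ->]]] := minor_incr f; first by exists 0.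
  by exists ((-1) ^+ b * Xi g); rewrite rmorphM rmorphXn rmorphN1.
exists M; split=> [||f].
- exists Xi'; split=> //; have [g [u [gu gx]]] := bezout_family Xi'.
  exists u; rewrite gu; suff -> : g = 1%N by [].
  apply/eqP; rewrite -dvdn1 -gXi; apply: (big_ind (fun x => g %| x)%N) => [|x y|h' _].
  + exact: dvdn0.
  + by rewrite dvdn_gcd => -> ->.
  have -> : Xi h' = Xi' (val h') by apply: (@intr_inj R); rewrite XiM -hXi'.
  exact: gx.
- by move=> v; rewrite -memv_span_rows (span_basis MB).
have le_H g : `|(Xi g)%:~R| <= H.
  rewrite eH -sqrtr_sqr ler_wsqrtr // (bigD1 g) //= lerDl sumr_ge0 // => k _.
  exact: sqr_ge0.
have [->|[g [b ->]]] := minor_incr f; first by rewrite normr0 eH sqrtr_ge0.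
by rewrite normrM normrX normrN1 expr1n mul1r.
Qed.

(** The exchange matrix at a nonzero minor spans [B], and its entries are minors, hence integers in
    a bounded interval. *)
Lemma finite_bounded_minors (R : realType) (n l : nat) (T : R) :
  finite_set [set B : {vspace 'rV[R]_n} | exists M : 'M[R]_(l, n),
    [/\ primitive M, forall v, (v \in B) = (v <= M)%MS & forall f, `|minor M f| <= T]].
Proof.
pose N := `|Num.floor T|%N.
(* Ordinals shifted by [N] encode the integers from -N to N. *)
pose ent (z : 'I_(N + N).+1) : R := z%:R - N%:R.
pose F (Z : 'M['I_(N + N).+1]_(l, n)) : {vspace 'rV[R]_n} :=
  <<[seq row i (map_mx ent Z) | i <- enum 'I_l]>>%VS.
apply: (@sub_finite_set _ _ (range F)); last first.
  by apply: finite_image; exact: finite_finset.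
move=> B [M [pM MB hM]]; have [Xi [f [hXi f0 _]]] := primitive_neq0 pM.
have XiN g : `|Xi g| <= N%:Z.
  have : (`|Xi g|)%:~R <= T by rewrite intr_norm -hXi.
  rewrite -floor_ge_int // => h; apply: le_trans h _; rewrite /N abszE; exact: ler_norm.
have zP j k : exists z : 'I_(N + N).+1, (Xi (ffun_upd f j k))%:~R = ent z.
  have := XiN (ffun_upd f j k); move: (Xi _) => x; rewrite ler_norml => /andP[x1 x2].
  have xN : (absz (x + N%:Z)%R < (N + N).+1)%N by lia.
  exists (Ordinal xN); rewrite /ent /= natr_absz ger0_norm; last by lia.
  by rewrite rmorphD /= addrK.
have /fin_all_exists [z hz] j := fin_all_exists (zP j).
exists (\matrix_(j, k) z j k) => //; apply/vspaceP => v; rewrite memv_span_rows MB.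
have -> : map_mx ent (\matrix_(j, k) z j k) = \adj (colsub f M) *m M.
  by rewrite adj_colsub; apply/matrixP=> j k; rewrite !mxE -hz -hXi.
have a0 : minor M f != 0 by rewrite hXi intr_eq0.
apply/idP/idP=> vM; apply: submx_trans vM _; first exact: submxMl.
apply/submxP; exists ((minor M f)^-1 *: colsub f M).
by rewrite mulmxA -scalemxAl mul_mx_adj scale_scalar_mx mulVf // mul1mx.
Qed.

Lemma kernel_space (R : fieldType) (n d : nat) (D : 'M[R]_(n, d)) :
  \rank D = d -> exists A : {vspace 'rV[R]_n},
    \dim A = (n - d)%N /\ forall v, (v \in A) = (v *m D == 0).
Proof.
move=> rD; pose L : 'Hom('rV[R]_n, 'rV[R]_d) := linfun (mulmxr D).
exists (lker L); split=> [|v]; last by rewrite memv_ker lfunE.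
have := limg_ker_dim L fullv; rewrite capfv.
have -> : (L @: fullv)%VS = fullv.
  apply/vspaceP=> w; rewrite memvf.
  have wD : (w <= D)%MS by apply: submx_full; rewrite /row_full rD.
  by rewrite -(mulmxKpV wD) -[_ *m D]/(mulmxr D _) -lfunE memv_img // memvf.
by rewrite !dimvf !dim_matrix !mul1r => /(canRL (addnK _)).
Qed.

(** * From the lower bound on proximity to the bound on the exponent *)

Unset Implicit Arguments.

Theorem theorem1p7 (R : realType) (d l : nat) (hd : (2 <= d)%N)
    (hl : (1 <= l <= d)%N) :
  (mu_inf R (2 * d) d l 1 <=
     ((2 * d%:R ^+ 2) / (2 * d%:R - l%:R) : R)%:E)%E.
Proof.
have /andP[l0 ld] := hl; set n := (2 * d)%N.
have dn : (0 < d <= n)%N by rewrite /n; lia.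
have ln : (l < n)%N by rewrite /n; lia.
have [D rD /(_ l ld) [c c0 hc]] := psi_lower_bound R dn.
have [A [dA AD]] := kernel_space rD.
have {}dA : \dim A = d by rewrite dA /n; lia.
have r0 : (0 < n - l)%N by rewrite subn_gt0.
have eNd : (n * (n - d) = 2 * d ^ 2)%N by rewrite /n; nia.
have rR : (2 * d%:R - l%:R : R) = (n - l)%:R by rewrite natrB ?natrM // ltnW.
(* Any bound on the minors, here the sum of their absolute values, lets [hc] exclude psi = 0.
   Irrationality of [A] follows, since a common nonzero vector v has psi(v, v) = 0. *)
have psi_gt0 (B : {vspace 'rV[R]_n}) V W : rational_subspaces l B ->
    V \in A -> W \in B -> V != 0 -> W != 0 -> psi V W != 0.
  move=> [rB dB]; rewrite AD => /eqP VA WB V0 W0.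
  have := rational_primitive rB; rewrite dB => /(_ l0)[M pM MB].
  have Mb f : `|minor M f| <= \sum_f `|minor M f| by rewrite (bigD1 f) //= lerDl sumr_ge0.
  have := hc M _ V W pM Mb VA; rewrite -MB => /(_ WB V0 W0).
  by apply: contraTneq => ->; rewrite expr0n eqn0Ngt r0 mul0r -ltNge.
apply: (@le_trans _ _ (mu_exponent A l 1)).
  apply: ereal_inf_lbound; exists A => //; split=> // B rB.
  rewrite ltnS leqn0 dimv_eq0; apply/eqP; apply: contrapT => /eqP nz.
  have := memv_pick (A :&: B)%VS; rewrite memv_cap => /andP[vA vB].
  have v0 : vpick (A :&: B)%VS != 0 by rewrite vpick0.
  have /negP[] := psi_gt0 B _ _ rB vA vB v0 v0.
  rewrite /psi /wedge_norm big1 ?sqrtr0 ?mul0r // => i _; rewrite big1 // => k _.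
  by rewrite [X in X - _]mulrC subrr expr0n.
apply: ge_ereal_sup => _ [->|[b [b0 infB] <-]].
  by rewrite lee_fin rR divr_ge0 ?mulr_ge0 ?exprn_ge0 ?ler0n.
rewrite lee_fin leNgt; apply/negP; rewrite rR ltr_pdivrMr ?ltr0n // => hb.
apply: infB.
(* The excess of b(n-l) over 2d^2: [hc] will give c <= H^(-de), that is, H is at most T =
   c^(-1/de). *)
pose de : R := b * (n - l)%:R - 2 * d%:R ^+ 2.
have de0 : 0 < de by rewrite subr_gt0.
pose T : R := (c^-1) `^ de^-1.
apply: sub_finite_set (finite_bounded_minors n l T) => B [rB hB].
have dB := rB.2; have dB0 : (0 < \dim B)%N by rewrite dB.
have dA0 : (0 < \dim A)%N by rewrite dA; lia.
have [X [Y [XA YB X0 Y0 eXY]]] := psi_1_attained dA0 dB0.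
rewrite eXY in hB.
have := height_primitive B; rewrite dB => -[H0|[M [pM MB hM]]].
  have := psi_gt0 B X Y rB XA YB X0 Y0; rewrite eq_le.
  by rewrite divr_ge0 ?mulr_ge0 ?sqrtr_ge0 // andbT; move: hB;
    rewrite H0 powR0 ?oppr_eq0 ?gt_eqF // => ->.
set H := height B in hB hM.
have H1 : 1 <= H := primitive_bound_ge1 pM hM.
have HT : H <= T.
  have H0 : 0 < H by apply: lt_le_trans H1.
  have psi0 : 0 <= psi X Y by rewrite divr_ge0 ?mulr_ge0 ?sqrtr_ge0.
  have cH : c <= H `^ (- de).
    have XD : X *m D = 0 by apply/eqP; rewrite -AD.
    have WM : (Y <= M)%MS by rewrite -MB.
    have := hc M H X Y pM hM XD WM X0 Y0; rewrite eNd.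
    move/le_trans; apply.
    have -> : H `^ (- de) = (H `^ (- b)) ^+ (n - l) * H ^+ (2 * d ^ 2).
      rewrite -!powR_mulrn ?powR_ge0 ?(ltW H0) // -powRrM -powRD ?(gt_eqF H0) ?implybT //.
      by congr (_ `^ _); rewrite natrM natrX /de; ring.
    by rewrite ler_wpM2r ?exprn_ge0 ?(ltW H0) // lerXn2r ?nnegrE ?powR_ge0.
  have Hde : H `^ de <= c^-1 by rewrite -(invrK (H `^ de)) -powRN lef_pV2 ?posrE ?powR_gt0.
  have -> : H = (H `^ de) `^ de^-1 by rewrite -powRrM mulfV ?gt_eqF // powRr1 // ltW.
  by rewrite ge0_ler_powR ?nnegrE ?powR_ge0 ?invr_ge0 ?(ltW de0) ?(ltW c0).
exists M; split=> // f; exact: le_trans (hM f) HT.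
Qed.
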